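(* Let $n,r,s,d,\delta\in\mathbb N$ with $(r-1)^2\le d+1$. Let $\mathbb F$ be a field of characteristic $p$ with $p=0$ or $p\ge rd\delta(s^2n+\delta)$. Then for every $\epsilon>0$ there is an explicit set $\mathcal H$ of points (in $\mathbb F^n$, or in $\mathbb E^n$ for an extension field $\mathbb E$ of $\mathbb F$ if $\mathbb F$ is too small) of size $|\mathcal H|=O(r^4s^4n^2d\delta^3/\epsilon)$ such that every nonzero polynomial computed by a $\Sigma^{[r]}\wedge^{[d]}\Sigma^{[s]}\Pi^{[\delta]}$ circuit over $\mathbb F$ is nonzero on at least a $(1-\epsilon)$ fraction of the points in $\mathcal H$.
   Context: A polynomial is $s$-sparse if it has at most $s$ monomials with nonzero coefficients. A $\Sigma^{[r]}\wedge^{[d]}\Sigma^{[s]}\Pi^{[\delta]}$ circuit over $\mathbb F$ computes a polynomial in $\mathbb F[x_1,\dots,x_n]$ of the form $\sum_{i=1}^r\alpha_i f_i^d$ with $\alpha_i\in\mathbb F$ and each $f_i$ an $s$-sparse polynomial of degree at most $\delta$. ''Explicit'' means the set can be constructed deterministically in time polynomial in its size. *)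

(* Defs.v *)
From mathcomp Require Export all_boot all_order all_algebra all_field.
From mathcomp Require Export mpoly.

Set Implicit Arguments.
Unset Strict Implicit.
Unset Printing Implicit Defensive.

Import GRing.Theory Num.Theory.
Local Open Scope ring_scope.

(* Circuits sum_{i<r} alpha_i f_i^d, f_i s-sparse of degree at most delta.
   msize is the total degree plus one, and msize 0 = 0. *)

Definition sparse (F : fieldType) (n s : nat) (f : {mpoly F[n]}) : Prop :=
  (size (msupp f) <= s)%N.

Definition sum_pow_sparse (F : fieldType) (n r d s delta : nat)
    (f : {mpoly F[n]}) : Prop :=
  exists (alpha : 'I_r -> F) (g : 'I_r -> {mpoly F[n]}),
    (forall i, sparse s (g i) /\ (msize (g i) <= delta.+1)%N) /\
    f = \sum_(i < r) alpha i *: g i ^+ d.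

Definition has_characteristic (F : fieldType) (p : nat) : Prop :=
  (p = 0%N /\ [pchar F] =i pred0) \/ p \in [pchar F].

(* "Explicit": a model of deterministic computation over a black-box field.
   Programs form a typed first-order call-by-value language with structural
   recursion on naturals and lists, in de Bruijn style.  The syntax does not
   mention the field, so one program runs over all fields.  The only field
   primitives are 0, 1, +, -, *, inverse and an equality test.  Naturals are
   built from 0 and successor only, so no large integer is available at unit
   cost. *)

Inductive ty : Type :=
| TNat
| TFld
| TProd of ty & ty
| TList of ty.

Inductive var : seq ty -> ty -> Type :=
| VZ G A : var (A :: G) A
| VS G A B : var G A -> var (B :: G) A.

Inductive tm : seq ty -> ty -> Type :=
| Var G A : var G A -> tm G A
| Let G A B : tm G A -> tm (A :: G) B -> tm G B
| Pair G A B : tm G A -> tm G B -> tm G (TProd A B)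
| Fst G A B : tm G (TProd A B) -> tm G A
| Snd G A B : tm G (TProd A B) -> tm G B
| Zero G : tm G TNat
| Succ G : tm G TNat -> tm G TNat
| NatCase G A : tm G TNat -> tm G A -> tm (TNat :: G) A -> tm G A
| NatRec G A : tm G TNat -> tm G A -> tm (TNat :: A :: G) A -> tm G A
| Nil G A : tm G (TList A)
| Cons G A : tm G A -> tm G (TList A) -> tm G (TList A)
| ListCase G A B :
    tm G (TList A) -> tm G B -> tm (A :: TList A :: G) B -> tm G B
| ListRec G A B : tm G (TList A) -> tm G B -> tm (A :: B :: G) B -> tm G B
| FZero G : tm G TFld
| FOne G : tm G TFld
| FAdd G : tm G TFld -> tm G TFld -> tm G TFld
| FOpp G : tm G TFld -> tm G TFld
| FMul G : tm G TFld -> tm G TFld -> tm G TFld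
| FInv G : tm G TFld -> tm G TFld
| FIfEq G A : tm G TFld -> tm G TFld -> tm G A -> tm G A -> tm G A.

Fixpoint den (F : fieldType) (A : ty) : Type :=
  match A with
  | TNat => nat
  | TFld => F
  | TProd A B => (den F A * den F B)%type
  | TList A => seq (den F A)
  end.

Fixpoint env (F : fieldType) (G : seq ty) : Type :=
  match G with
  | [::] => unit
  | A :: G => (den F A * env F G)%type
  end.

Fixpoint lookup (F : fieldType) G A (v : var G A) : env F G -> den F A :=
  match v with
  | VZ _ _ => fun e => e.1
  | VS _ _ _ v => fun e => lookup v e.2
  end.

Fixpoint eval (F : fieldType) G A (t : tm G A) : env F G -> den F A :=
  match t in tm G A return env F G -> den F A with
  | Var _ _ v => fun e => lookup v e
  | Let _ _ _ t u => fun e => eval u (eval t e, e)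
  | Pair _ _ _ t u => fun e => (eval t e, eval u e)
  | Fst _ _ _ t => fun e => (eval t e).1
  | Snd _ _ _ t => fun e => (eval t e).2
  | Zero _ => fun _ => 0%N
  | Succ _ t => fun e => (eval t e).+1
  | NatCase _ _ t u w => fun e =>
      if eval t e is k.+1 then eval w (k, e) else eval u e
  | NatRec _ _ t u w => fun e =>
      iteri (eval t e) (fun k a => eval w (k, (a, e))) (eval u e)
  | Nil _ _ => fun _ => [::]
  | Cons _ _ t u => fun e => eval t e :: eval u e
  | ListCase _ _ _ t u w => fun e =>
      if eval t e is x :: l then eval w (x, (l, e)) else eval u e
  | ListRec _ _ _ t u w => fun e =>
      foldr (fun x b => eval w (x, (b, e))) (eval u e) (eval t e)
  | FZero _ => fun _ => 0 : F
  | FOne _ => fun _ => 1 : F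
  | FAdd _ t u => fun e => (eval t e : F) + eval u e
  | FOpp _ t => fun e => - (eval t e : F)
  | FMul _ t u => fun e => (eval t e : F) * eval u e
  | FInv _ t => fun e => (eval t e : F)^-1
  | FIfEq _ _ t u v w => fun e =>
      if (eval t e : F) == eval u e then eval v e else eval w e
  end.

Fixpoint foldr_cost (X B : Type) (f : X -> B -> B) (c : X -> B -> nat) (b : B)
    (l : seq X) : nat :=
  if l is x :: l' then (c x (foldr f b l') + foldr_cost f c b l')%N else 0%N.

(* Running time: every evaluation of a node of the program, including each
   evaluation of the body of a recursion, counts for one step. *)
Fixpoint cost (F : fieldType) G A (t : tm G A) : env F G -> nat :=
  match t in tm G A return env F G -> nat with
  | Var _ _ _ => fun _ => 1%N
  | Let _ _ _ t u => fun e => (cost t e + cost u (eval t e, e)).+1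
  | Pair _ _ _ t u => fun e => (cost t e + cost u e).+1
  | Fst _ _ _ t => fun e => (cost t e).+1
  | Snd _ _ _ t => fun e => (cost t e).+1
  | Zero _ => fun _ => 1%N
  | Succ _ t => fun e => (cost t e).+1
  | NatCase _ _ t u w => fun e =>
      (cost t e + if eval t e is k.+1 then cost w (k, e) else cost u e)%N.+1
  | NatRec _ _ t u w => fun e =>
      (cost t e + cost u e +
       \sum_(k < eval t e)
         cost w (nat_of_ord k,
                 (iteri k (fun j a => eval w (j, (a, e))) (eval u e), e)))%N.+1
  | Nil _ _ => fun _ => 1%N
  | Cons _ _ t u => fun e => (cost t e + cost u e).+1
  | ListCase _ _ _ t u w => fun e =>
      (cost t e + if eval t e is x :: l then cost w (x, (l, e))
                  else cost u e)%N.+1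
  | ListRec _ _ _ t u w => fun e =>
      (cost t e + cost u e +
       foldr_cost (fun x b => eval w (x, (b, e)))
                  (fun x b => cost w (x, (b, e))) (eval u e) (eval t e))%N.+1
  | FZero _ => fun _ => 1%N
  | FOne _ => fun _ => 1%N
  | FAdd _ t u => fun e => (cost t e + cost u e).+1
  | FOpp _ t => fun e => (cost t e).+1
  | FMul _ t u => fun e => (cost t e + cost u e).+1
  | FInv _ t => fun e => (cost t e).+1
  | FIfEq _ _ t u v w => fun e =>
      (cost t e + cost u e +
       if (eval t e : F) == eval u e then cost v e else cost w e)%N.+1
  end.

(* Inputs n, r, s, d, delta, floor(1/eps) and a list of elements of F: an
   abstract field provides no other way to name elements outside its prime
   field.  The output (g, pts) consists of the coefficients, constant term
   first, of a polynomial g such that the points live in E^n for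
   E = F[X]/(g), and of a list of points; a point is the list of its
   coordinates, and a coordinate is the list of coefficients of a (not
   necessarily reduced) polynomial in the class of X. *)
Definition hs_program : Type :=
  tm [:: TNat; TNat; TNat; TNat; TNat; TNat; TList TFld]
     (TProd (TList TFld) (TList (TList (TList TFld)))).

Definition hs_input (F : fieldType) (n r s d delta k : nat) (elts : seq F) :
    env F [:: TNat; TNat; TNat; TNat; TNat; TNat; TList TFld] :=
  (n, (r, (s, (d, (delta, (k, (elts, tt))))))).

Definition root_presents (F : fieldType) (E : fieldExtType F) (g : {poly F})
    (theta : E) : Prop :=
  [/\ irreducible_poly g, root (map_poly (in_alg E) g) theta &
      <<1; theta>>%VS = fullv].

Definition decode_point (F : fieldType) (E : fieldExtType F) (theta : E)
    (n : nat) (pt : seq (seq F)) : {ffun 'I_n -> E} :=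
  [ffun i : 'I_n => (map_poly (in_alg E) (Poly (nth [::] pt i))).[theta]].

Definition nonzero_count (F : fieldType) (E : fieldExtType F) (n : nat)
    (f : {mpoly F[n]}) (H : seq {ffun 'I_n -> E}) : nat :=
  count (fun v : {ffun 'I_n -> E} => (map_mpoly (in_alg E) f).@[v] != 0) H.

(* Main.v *)
Require Import Defs.
From HB Require Import structures.
From Stdlib Require Import Classical.
From mathcomp Require Import fingroup perm cyclic zify ring.
Set Implicit Arguments.
Unset Strict Implicit.
Unset Printing Implicit Defensive.
Import Order.TTheory GRing.Theory Num.Theory.
Local Open Scope ring_scope.

(* The points are taken on the curve x_0 = z, x_a = (z + a)^i (0 < a < n) with
   i = r s^2 n, so only the restriction of a circuit to the curve, a polynomial
   in z of degree at most D = d delta i < p, has to be shown nonzero; D (k + 1)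
   parameters z then give an error below eps, where k = floor (1/eps).

   Both nonvanishing facts come from one Mason-Stothers type bound. If h_0 +
   ... + h_k = 0 is a minimal relation without common factor, all the
   Wronskians of k of the h_j agree up to sign, are nonzero in small degree,
   and have degree at most the sum of the degrees minus k (k - 1) / 2; if
   moreover R times every term of such a Wronskian is divisible by the product
   of the k functions involved, then the product of all the h_j divides R times
   the Wronskian, so deg h_j + k (k - 1) / 2 <= deg R for every j. Applied to
   monomials on the curve, it shows that a nonzero polynomial with few
   monomials restricts to a nonzero one, so pairwise non-proportional sparse
   polynomials stay so on the curve. Applied to d-th powers of these, it shows
   that they are linearly independent when (r - 1)^2 <= d + 1.

   If F has too few elements, the program lists all tuples of the least length m
   for which there are enough of them, and finds an irreducible monic polynomial
   of degree m by trying all products.  Coordinates are left unreduced modulo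
   this polynomial. *)

(** * Linear relations *)

Section LinearRelations.

Variables (F : fieldType) (V : lmodType F).

Definition lin_indep (I : finType) (f : I -> V) : Prop :=
  forall c : I -> F, \sum_i c i *: f i = 0 -> forall i, c i = 0.

Definition minimal_relation k (h : 'I_k.+1 -> V) : Prop :=
  \sum_j h j = 0 /\
    forall j0 : 'I_k.+1, lin_indep (fun j : 'I_k => h (lift j0 j)).

Definition nonproportional (I : finType) (f : I -> V) : Prop :=
  (forall i, f i != 0) /\ forall i j a, f i = a *: f j -> i = j.

Lemma lin_indep_inj (I J : finType) (f : I -> V) (e : J -> I) :
  injective e -> lin_indep f -> lin_indep (f \o e).
Proof.
move=> e_inj f_ind c c_rel j.
pose c' i := \sum_(j | e j == i) c j.
have c'E j' : c' (e j') = c j'.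
  by rewrite /c' (big_pred1 j') // => j''; rewrite (inj_eq e_inj).
rewrite -c'E; apply: f_ind; rewrite -[RHS]c_rel.
under eq_bigr => i _ do rewrite /c' scaler_suml.
rewrite (exchange_big_dep predT) //=; apply: eq_bigr => j' _.
by rewrite (big_pred1 (e j')) // => i; rewrite eq_sym.
Qed.

Lemma lin_indepZ (I : finType) (f : I -> V) (a : I -> F) :
  (forall i, a i != 0) -> lin_indep f -> lin_indep (fun i => a i *: f i).
Proof.
move=> a_neq0 f_ind c c_rel i.
suff /eqP : c i * a i = 0 by rewrite mulf_eq0 (negPf (a_neq0 i)) orbF => /eqP.
apply: (f_ind (fun i => c i * a i)); rewrite -[RHS]c_rel.
by apply: eq_bigr => j _; rewrite scalerA.
Qed.

Lemma enum_minimal_relation (I : finType) (f : I -> V) (c : I -> F) k :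
    (forall i, c i != 0) -> \sum_i c i *: f i = 0 ->
    (forall i0, lin_indep (fun i : {i | i \in predC1 i0} => f (val i))) ->
    #|I| = k.+1 ->
  exists e : 'I_k.+1 -> I,
    injective e /\ minimal_relation (fun j => c (e j) *: f (e j)).
Proof.
move=> c_neq0 c_rel ind_but cardI.
pose e j := enum_val (cast_ord (esym cardI) j).
have e_inj : injective e by move=> j j' /enum_val_inj/cast_ord_inj.
exists e; split=> //; split.
  rewrite -[RHS]c_rel (reindex e) //.
  exists (cast_ord cardI \o enum_rank) => i _ /=.
    by rewrite /e enum_valK cast_ordKV.
  by rewrite /e cast_ordK enum_rankK.
move=> j0; apply: (@lin_indepZ _ _ (fun j => c (e (lift j0 j)))) => //.
have e_lift (j : 'I_k) : e (lift j0 j) \in predC1 (e j0).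
  by rewrite inE (inj_eq e_inj) eq_sym neq_lift.
apply: (lin_indep_inj (e := fun j => Sub (e (lift j0 j)) (e_lift j)))
  (ind_but (e j0)).
by move=> j j' /(congr1 val)/e_inj/lift_inj.
Qed.

Lemma minimal_relation_exists (I : finType) (f : I -> V) :
    ~ lin_indep f ->
  exists k (e : 'I_k.+1 -> I) (c : 'I_k.+1 -> F),
    [/\ injective e, forall j, c j != 0 &
        minimal_relation (fun j => c j *: f (e j))].
Proof.
have [m] := ubnP #|I|; elim: m I f => // m IHm I f ltIm f_dep.
have [[i0 dep_i0]|ind_but] :=
    classic
      (exists i0, ~ lin_indep (fun i : {i | i \in predC1 i0} => f (val i))).
  have [|k [e [c [e_inj c_neq0 rel]]]] := IHm _ _ _ dep_i0.
    rewrite card_sig [#|_|](cardC1 i0); apply: leq_trans (ltIm : #|I| <= m)%N.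
    by rewrite ltn_predL; apply/card_gt0P; exists i0.
  by exists k, (val \o e), c; split=> //; apply: inj_comp val_inj e_inj.
have {}ind_but i0 : lin_indep (fun i : {i | i \in predC1 i0} => f (val i)).
  by apply: NNPP => dep_i0; apply: ind_but; exists i0.
have [c c_rel [i1 ci1]] :
    exists2 c : I -> F, \sum_i c i *: f i = 0 & exists i, c i != 0.
  apply: NNPP => no_rel; apply: f_dep => c c_rel i; apply/eqP/negPn/negP => ci.
  by apply: no_rel; exists c => //; exists i.
have c_neq0 i0 : c i0 != 0.
  apply: contraNneq ci1 => ci0; have [->|ne_i1] := eqVneq i1 i0;
    first exact/eqP.
  apply/eqP; apply: (ind_but i0 (c \o val) _ (Sub i1 ne_i1)).
  rewrite -(big_sub (predC1 i0) (fun i => c i *: f i)) -[RHS]c_rel.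
  by rewrite [RHS](bigD1 i0) //= ci0 scale0r add0r.
have [k cardI] : exists k, #|I| = k.+1.
  by exists #|I|.-1; rewrite prednK //; apply/card_gt0P; exists i1.
have [e [e_inj rel]] := enum_minimal_relation c_neq0 c_rel ind_but cardI.
by exists k, e, (c \o e); split=> // j; apply: c_neq0.
Qed.

End LinearRelations.

Section ProportionalSums.

Variables (F : fieldType) (A : algType F) (d : nat).
Hypothesis d_gt0 : (0 < d)%N.

Lemma sum_pow_drop r (c : 'I_r.+1 -> F) (g : 'I_r.+1 -> A) :
    ~ nonproportional g ->
  exists (i : 'I_r.+1) (c' : 'I_r -> F),
    \sum_j c j *: g j ^+ d = \sum_j c' j *: g (lift i j) ^+ d.
Proof.
move=> g_prop.
have [[i gi0]|g_neq0] := classic (exists i, g i = 0).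
  exists i, (c \o lift i); rewrite (bigD1_ord i) //= gi0 expr0n.
  by rewrite eqn0Ngt d_gt0 scaler0 add0r.
have [i [j [a [gij ne_ij]]]] : exists i j a, g i = a *: g j /\ i <> j.
  apply: NNPP => no_dep; apply: g_prop; split=> [i|i j a gij].
    by apply/eqP => gi0; apply: g_neq0; exists i.
  by apply: NNPP => ne_ij; apply: no_dep; exists i, j, a.
have [j' jE|jE] := unliftP i j; last by case: ne_ij.
exists i, (fun l => c (lift i l) + (if l == j' then c i * a ^+ d else 0)).
rewrite (bigD1_ord i) //= addrC; under [RHS]eq_bigr do rewrite scalerDl.
rewrite big_split /=; congr (_ + _).
rewrite (bigD1 j') //= eqxx big1 => [|l /negPf->].
  by rewrite addr0 gij jE exprZn scalerA.
by rewrite scale0r.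
Qed.

Lemma sum_pow_nonproportional r (c : 'I_r -> F) (g : 'I_r -> A) :
  exists r' (e : 'I_r' -> 'I_r) (c' : 'I_r' -> F),
    [/\ (r' <= r)%N, nonproportional (g \o e) &
        \sum_j c j *: g j ^+ d = \sum_j c' j *: g (e j) ^+ d].
Proof.
elim: r c g => [|r IHr] c g.
  by exists 0%N, id, c; split=> //; split; case.
have [g_nonprop|/(sum_pow_drop c) [i [c1 ->]]] := classic (nonproportional g).
  by exists r.+1, id, c.
have [r' [e [c' [le_r' ge_nonprop ->]]]] := IHr c1 (g \o lift i).
by exists r', (lift i \o e), c'; split=> //; apply: leqW.
Qed.

End ProportionalSums.

(** * Wronskians *)

Definition pchar_gt (F : fieldType) (T : nat) : Prop :=
  forall p, p \in [pchar F] -> (T < p)%N.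

Section LargeCharacteristic.

Variables (F : fieldType) (T : nat).
Hypothesis charF : pchar_gt F T.

Lemma pchar_gt_leq S : (S <= T)%N -> pchar_gt F S.
Proof. by move=> leST p /charF; apply: leq_ltn_trans. Qed.

Lemma natr_eq0_leq m : (m <= T)%N -> m%:R = 0 :> F -> m = 0%N.
Proof.
move=> leT m0; apply: contraTeq leT; rewrite -lt0n -ltnNge => m_gt0.
have [|p pF] := @natf0_pchar F m m_gt0; first exact/eqP.
by apply: leq_trans (charF pF) _; rewrite dvdn_leq // (dvdn_pcharf pF) m0.
Qed.

Lemma natr_inj_near m n :
  (m <= n + T)%N -> (n <= m + T)%N -> m%:R = n%:R :> F -> m = n.
Proof.
move=> le_mn le_nm; wlog le : m n le_mn le_nm / (m <= n)%N => [IH eq_mn|eq_mn].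
  by case/orP: (leq_total m n) => ?; [|apply/esym]; apply: IH.
have : (n - m = 0)%N.
  by apply: natr_eq0_leq; [lia | rewrite natrB // eq_mn subrr].
by lia.
Qed.

Lemma deriv0_coef (p : {poly F}) a : p^`() = 0 -> p`_a != 0 -> a%:R = 0 :> F.
Proof.
case: a => // a dp0 pa; have := congr1 (fun q : {poly F} => q`_a) dp0.
by rewrite coef_deriv coef0 -[_ *+ _]mulr_natr => /eqP;
  rewrite mulf_eq0 (negPf pa) => /eqP.
Qed.

(* [p' = 0] confines the exponents of [p] to multiples of the characteristic,
   which exceeds [size q]: different exponents of [p] do not interact. *)
Lemma coefM_deriv0 (p q : {poly F}) a t :
    p^`() = 0 -> (size q <= T.+1)%N -> a%:R = 0 :> F -> (t <= T)%N ->
  (p * q)`_(a + t) = p`_a * q`_t.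
Proof.
move=> dp0 qT a0 tT; have lt_a : (a < (a + t).+1)%N by rewrite ltnS leq_addr.
rewrite coefM (bigD1 (Ordinal lt_a)) //= addKn big1 ?addr0 // => b ne_ba.
have [->|pb] := eqVneq p`_b 0; first by rewrite mul0r.
have [le_q|lt_q] := leqP (size q) (a + t - b);
  first by rewrite [q`__]nth_default ?mulr0.
case/eqP: ne_ba; apply: val_inj; have := ltn_ord b => /= lt_b.
by apply: natr_inj_near; [lia..|rewrite a0 (deriv0_coef dp0 pb)].
Qed.

Lemma lin_indep_deriv0 (I : finType) (h v : I -> {poly F}) :
    (forall i, size (h i) <= T.+1)%N -> lin_indep h ->
    (forall i, (v i)^`() = 0) -> \sum_i v i * h i = 0 ->
  forall i, v i = 0.
Proof.
move=> hT h_ind dv0 vh0 i; apply/polyP => a; rewrite coef0.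
have [a0|/eqP a_neq0] := eqVneq (a%:R : F) 0; last first.
  by apply/eqP/negPn/negP => /(deriv0_coef (dv0 i)).
move: i; apply: h_ind; apply/polyP => t; rewrite coef0 coef_sum.
have [le_tT|lt_Tt] := leqP t T; last first.
  by apply: big1 => i _;
    rewrite coefZ [(h i)`_t]nth_default ?mulr0 // (leq_trans (hT i)).
have := congr1 (fun q : {poly F} => q`_(a + t)) vh0.
rewrite coef0 coef_sum => vh_at.
by rewrite -[RHS]vh_at; apply: eq_bigr => i _; rewrite coefZ coefM_deriv0.
Qed.

End LargeCharacteristic.

Definition wronskian_mx (F : fieldType) (k : nat) (h : 'I_k -> {poly F}) :
    'M[{poly F}]_k := \matrix_(j, l) (h j)^`(l).

Definition annihilates_derivs (F : fieldType) (l k : nat)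
    (v h : 'I_k -> {poly F}) : Prop :=
  forall i, (i < l)%N -> \sum_j v j * (h j)^`(i) = 0.

Section Wronskian.

Variable F : fieldType.

Lemma det_wronskian_neq0P k (h : 'I_k -> {poly F}) :
  \det (wronskian_mx h) != 0 <->
  forall v, annihilates_derivs k v h -> forall j, v j = 0.
Proof.
split=> [det_neq0 v v_ann j | h_free].
  apply/eqP/negPn/negP => vj; case/negP: det_neq0; apply/det0P.
  exists (\row_j v j).
    by apply: contraNneq vj => /rowP/(_ j); rewrite !mxE => ->.
  apply/rowP => l; rewrite !mxE -[RHS](v_ann l (ltn_ord l)).
  by apply: eq_bigr => i _; rewrite !mxE.
apply/det0P => -[v /eqP v_neq0 /rowP v_ker]; apply/v_neq0/rowP => j.
rewrite mxE; apply: (h_free (fun j => v 0 j)) => l lt_lk.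
have := v_ker (Ordinal lt_lk); rewrite !mxE => v_kerl; rewrite -[RHS]v_kerl.
by apply: eq_bigr => i _; rewrite !mxE.
Qed.

Lemma annihilates_derivs_deriv l k (v h : 'I_k -> {poly F}) :
  annihilates_derivs l.+1 v h -> annihilates_derivs l (deriv \o v) h.
Proof.
move=> v_ann i lt_il; have := congr1 (@deriv _) (v_ann i (ltnW lt_il)).
rewrite raddf_sum raddf0 /= => d_sum; rewrite -[RHS]d_sum.
under [RHS]eq_bigr do rewrite derivM -derivnS.
by rewrite big_split /= [X in _ + X](v_ann i.+1) ?addr0.
Qed.

Section LastFunction.

Variables (k : nat) (h : 'I_k.+1 -> {poly F}).
Hypothesis W_neq0 : \det (wronskian_mx (h \o lift ord_max)) != 0.

Lemma annihilates_derivs_last0 v :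
  annihilates_derivs k v h -> v ord_max = 0 -> forall j, v j = 0.
Proof.
move=> v_ann v_last j; have [j' ->|->//] := unliftP ord_max j.
apply: (iffLR (det_wronskian_neq0P _) W_neq0 (v \o lift ord_max)) => i lt_ik.
by rewrite -[RHS](v_ann i lt_ik) (bigD1_ord ord_max) //= v_last mul0r add0r.
Qed.

Lemma annihilates_derivs_proportional u v :
    annihilates_derivs k u h -> annihilates_derivs k v h ->
  forall j, v ord_max * u j = u ord_max * v j.
Proof.
move=> u_ann v_ann j; apply/eqP; rewrite -subr_eq0; apply/eqP; move: j.
apply: annihilates_derivs_last0 => [i lt_ik|]; last by rewrite mulrC subrr.
under eq_bigr do rewrite mulrBl -!mulrA.
by rewrite sumrB -!mulr_sumr u_ann // v_ann // !mulr0 subrr.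
Qed.

Lemma annihilates_derivs_stable v :
    annihilates_derivs k.+1 v h -> v ord_max != 0 ->
  annihilates_derivs k.+1 (deriv \o v) h.
Proof.
move=> v_ann v_last i lt_ik; apply: (mulfI v_last); rewrite mulr0 mulr_sumr.
have dv_ann := annihilates_derivs_deriv v_ann.
have v_ann_k : annihilates_derivs k v h by move=> ? /ltnW; apply: v_ann.
have prop := annihilates_derivs_proportional dv_ann v_ann_k.
under eq_bigr do rewrite mulrA prop -mulrA.
by rewrite -mulr_sumr v_ann // mulr0.
Qed.

End LastFunction.

(* An annihilating vector whose last entry has least size is killed by
   differentiation, since its derivative is again annihilating. *)
Lemma det_wronskian_neq0 T k (h : 'I_k -> {poly F}) :
    pchar_gt F T -> (forall j, size (h j) <= T.+1)%N -> lin_indep h ->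
  \det (wronskian_mx h) != 0.
Proof.
move=> charF; elim: k h => [|k IHk] h hT h_ind;
  first by rewrite det_mx00 oner_eq0.
have W_neq0 : \det (wronskian_mx (h \o lift ord_max)) != 0.
  by apply: IHk => [j|]; [exact: hT | exact: lin_indep_inj lift_inj h_ind].
apply/det_wronskian_neq0P => v v_ann.
have [m] := ubnP (size (v ord_max)); elim: m v v_ann => // m IHm v v_ann lt_vm.
have [v_last|v_last] := eqVneq (v ord_max) 0.
  by apply: (annihilates_derivs_last0 W_neq0) v_last => i /ltnW; apply: v_ann.
have dv_ann := annihilates_derivs_stable W_neq0 v_ann v_last.
have dv0 := IHm _ dv_ann (leq_trans (lt_size_deriv v_last) lt_vm).
exact: (lin_indep_deriv0 charF hT h_ind dv0) (v_ann 0%N isT).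
Qed.

End Wronskian.

Section Degree.

Variable F : fieldType.
Implicit Types p q : {poly F}.

Definition degp p := (size p).-1.

Lemma degp_leq p n : (degp p <= n)%N = (size p <= n.+1)%N.
Proof. by rewrite /degp; case: (size p). Qed.

Lemma degpM p q : p != 0 -> q != 0 -> degp (p * q) = (degp p + degp q)%N.
Proof.
by move=> p_neq0 q_neq0;
  rewrite /degp size_mul // (polySpred p_neq0) (polySpred q_neq0) addnS.
Qed.

Lemma degp_exp p m : degp (p ^+ m) = (degp p * m)%N.
Proof. exact: size_exp. Qed.

Lemma degpZ a p : a != 0 -> degp (a *: p) = degp p.
Proof. by move=> a_neq0; rewrite /degp size_scale. Qed.

Lemma degp_prod (I : finType) (f : I -> {poly F}) :
  (forall i, f i != 0) -> degp (\prod_i f i) = (\sum_i degp (f i))%N.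
Proof.
move=> f_neq0; rewrite /degp size_prod //.
have -> : (\sum_i size (f i) = \sum_i degp (f i) + #|I|)%N.
  rewrite -sum1_card -big_split; apply: eq_bigr => i _.
  by rewrite (polySpred (f_neq0 i)) -addn1.
by rewrite -addSn addnK.
Qed.

Lemma dvdp_degp p q : q != 0 -> p %| q -> (degp p <= degp q)%N.
Proof. by move=> q_neq0 /(dvdp_leq q_neq0); rewrite degp_leq -polySpred. Qed.

Lemma degp_derivn p l : p^`(l) != 0 -> (degp p^`(l) + l <= degp p)%N.
Proof.
elim: l => [|l IHl]; first by rewrite derivn0 addn0.
rewrite derivnS => d_neq0.
have dl_neq0 : p^`(l) != 0 by apply: contraNneq d_neq0 => ->; rewrite deriv0.
have := lt_size_deriv dl_neq0.
rewrite (polySpred d_neq0) (polySpred dl_neq0) ltnS => lt_d.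
by apply: leq_trans (IHl dl_neq0); rewrite addnS ltn_add2r.
Qed.

End Degree.

Lemma det_row'_sum0 (R : idomainType) k (M : 'M[R]_(k.+1, k)) :
    (forall l, \sum_j M j l = 0) ->
  forall i j : 'I_k.+1, (-1) ^+ i * \det (row' i M) =
    (-1) ^+ j * \det (row' j M).
Proof.
move=> M_sum0 i j.
have sum_delta (f : 'I_k.+1 -> R) a0 : \sum_a (a == a0)%:R * f a = f a0.
  by under eq_bigr do rewrite mulr_natl mulrb; rewrite -big_mkcond big_pred1_eq.
pose x a : R := (a == i)%:R - (a == j)%:R.
pose A := \matrix_(a, b) if unlift ord0 b is Some l then M a l else x a.
have detA0 : \det A = 0.
  apply/eqP/det0P; exists (const_mx 1).
    by apply/eqP => /rowP/(_ ord0)/eqP; rewrite !mxE oner_eq0.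
  apply/rowP => b; rewrite !mxE; under eq_bigr do rewrite !mxE.
  case: (unlift ord0 b) => [l|]; under eq_bigr do rewrite mulrC.
    by under eq_bigr do rewrite mulr1; apply: M_sum0.
  by under eq_bigr do rewrite mulrBl;
    rewrite sumrB !(sum_delta (fun=> 1)) subrr.
have cofA a :
    A a ord0 * cofactor A a ord0 = x a * ((-1) ^+ a * \det (row' a M)).
  rewrite mxE unlift_none /cofactor addn0; congr (_ * (_ * \det _)).
  by apply/matrixP => b l; rewrite !mxE liftK.
move: detA0; rewrite (expand_det_col _ ord0);
  under eq_bigr do rewrite cofA mulrBl.
by rewrite sumrB !(sum_delta (fun a => (-1) ^+ a * \det (row' a M))) => /eqP;
  rewrite subr_eq0 => /eqP.
Qed.

(** * A Mason-Stothers bound *)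

Definition coprime_family (F : fieldType) (I : finType)
    (h : I -> {poly F}) : Prop :=
  forall p, (forall i, p %| h i) -> p %| 1.

Section CoprimeFamilies.

Variables (F : fieldType) (I : finType).
Implicit Types (h q : I -> {poly F}) (p r : {poly F}).

Lemma coprime_family_dvd h p r :
  coprime_family h -> (forall i, p %| h i * r) -> p %| r.
Proof.
move=> h_coprime p_dvd; have [->|r_neq0] := eqVneq r 0; first exact: dvdp0.
set g := gcdp p r.
have g_neq0 : g != 0 by rewrite gcdp_eq0 negb_and r_neq0 orbT.
have quo_coprime : coprimep (p %/ g) (r %/ g).
  by rewrite coprimep_div_gcd ?r_neq0 ?orbT.
rewrite -(divpK (dvdp_gcdr p r)) -{1}(divpK (dvdp_gcdl p r)) dvdp_mul2r //.
apply: dvdp_trans (dvd1p _); apply: h_coprime => i.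
rewrite -(Gauss_dvdpl _ quo_coprime) -(dvdp_mul2r _ _ g_neq0) -mulrA.
by rewrite !divpK ?dvdp_gcdl ?dvdp_gcdr.
Qed.

Lemma big_gcdp_dvd h (s : seq I) i :
  i \in s -> \big[@gcdp F/0]_(j <- s) h j %| h i.
Proof.
elim: s => // j s IHs; rewrite inE big_cons => /predU1P[->|/IHs];
  first exact: dvdp_gcdl.
exact: dvdp_trans (dvdp_gcdr _ _).
Qed.

Lemma dvdp_big_gcdp h (s : seq I) p :
  (forall i, p %| h i) -> p %| \big[@gcdp F/0]_(j <- s) h j.
Proof.
by move=> p_dvd; elim/big_rec: _ => [|j g _ p_g];
  rewrite ?dvdp0 ?dvdp_gcd ?p_dvd.
Qed.

Lemma coprime_quotients h i0 :
    h i0 != 0 ->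
  exists (D : {poly F}) q,
    [/\ D != 0, forall i, h i = q i * D & coprime_family q].
Proof.
set D := \big[@gcdp F/0]_j h j => h_neq0.
have D_dvd i : D %| h i by apply: big_gcdp_dvd; rewrite mem_index_enum.
have D_neq0 : D != 0 by apply: contraNneq h_neq0 => D0; rewrite -dvd0p -D0.
exists D, (fun i => h i %/ D); split=> // [i|p p_dvd]; first by rewrite divpK.
rewrite -(dvdp_mul2r _ _ D_neq0) mul1r; apply: dvdp_big_gcdp => i.
by rewrite -(divpK (D_dvd i)) dvdp_mul2r.
Qed.

(* A nonunit common divisor of the powers yields one of the family: replace it
   by its gcd with each member in turn. *)
Lemma coprime_family_exp q d :
  coprime_family q -> coprime_family (fun i => q i ^+ d).
Proof.
move=> q_coprime p p_dvd.
suff common_divisor (s : seq I) : ~~ (p %| 1) ->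
    exists r, [/\ ~~ (r %| 1), r %| p & forall i, i \in s -> r %| q i].
  apply/negPn/negP => /(common_divisor (index_enum I)) [r [r_nunit _ r_dvd]].
  by case/negP: r_nunit; apply: q_coprime => i; apply: r_dvd;
    apply: mem_index_enum.
move=> p_nunit; elim: s => [|i s [r [r_nunit r_p r_s]]]; first by exists p.
exists (gcdp r (q i)); split.
- apply: contra r_nunit => gcd_unit.
  have r_coprime : coprimep r (q i) by rewrite /coprimep -dvdp1.
  rewrite dvdp1 -coprimepp; apply: coprimep_dvdl (coprimep_expr d r_coprime).
  exact: dvdp_trans r_p (p_dvd i).
- exact: dvdp_trans (dvdp_gcdl _ _) r_p.
move=> j; rewrite inE => /predU1P[->|/r_s]; first exact: dvdp_gcdr.
exact: dvdp_trans (dvdp_gcdl _ _).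
Qed.

End CoprimeFamilies.

Lemma sum_perm_ord k (s : 'S_k) : (\sum_(j < k) s j)%N = 'C(k, 2).
Proof.
by rewrite -bin2_sum big_mkord [RHS](reindex_perm s).
Qed.

Lemma degp_det_wronskian (F : fieldType) k (h : 'I_k -> {poly F}) :
    \det (wronskian_mx h) != 0 ->
  (degp (\det (wronskian_mx h)) + 'C(k, 2) <= \sum_j degp (h j))%N.
Proof.
move=> W_neq0; set S := (\sum_j _)%N.
suff : (size (\det (wronskian_mx h)) <= S.+1 - 'C(k, 2))%N.
  by rewrite (polySpred W_neq0) -/(degp _) ltn_subRL addnC ltnS.
apply: leq_trans (size_sum _ _ _) _; apply/bigmax_leqP => s _.
rewrite size_Msign; under eq_bigr do rewrite mxE; set P := \prod_j _.
have [->|P_neq0] := eqVneq P 0; first by rewrite size_poly0.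
have d_neq0 j : (h j)^`(s j) != 0 by have/prodf_neq0 := P_neq0; apply.
rewrite (polySpred P_neq0) -/(degp P) ltn_subRL addnC ltnS.
rewrite degp_prod // -(sum_perm_ord s) -big_split leq_sum // => j _.
exact: degp_derivn.
Qed.

Section MasonStothers.

Variables (F : fieldType) (T k : nat) (h : 'I_k.+1 -> {poly F}) (R : {poly F}).
Hypothesis charF : pchar_gt F T.
Hypothesis h_size : forall j, (size (h j) <= T.+1)%N.
Hypothesis h_neq0 : forall j, h j != 0.
Hypothesis h_rel : minimal_relation h.
Hypothesis h_coprime : coprime_family h.
Hypothesis R_neq0 : R != 0.
Hypothesis R_dvd : forall (j0 : 'I_k.+1) (s : 'S_k),
  \prod_j h (lift j0 j) %| R * \prod_j (h (lift j0 j))^`(s j).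

Let W (j0 : 'I_k.+1) : 'M_k := wronskian_mx (fun j : 'I_k => h (lift j0 j)).

Let det_neq0 j0 : \det (W j0) != 0.
Proof.
by apply: (det_wronskian_neq0 charF) => [j|]; [exact: h_size | exact: h_rel.2].
Qed.

Let det_eqp i j : \det (W i) %= \det (W j).
Proof.
pose M : 'M_(k.+1, k) := \matrix_(a, l) (h a)^`(l).
have W_row' a : W a = row' a M by apply/matrixP => b l; rewrite !mxE.
have sign_eqp m (p : {poly F}) : (-1) ^+ m * p %= p.
  by rewrite -(rmorph_sign polyC) mul_polyC eqp_scale // signr_eq0.
have M_sum0 l : \sum_a M a l = 0.
  under eq_bigr do rewrite mxE.
  by rewrite -(raddf_sum (derivn l)) h_rel.1 raddf0.
have := sign_eqp i (\det (row' i M)).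
rewrite (det_row'_sum0 M_sum0 i j) eqp_sym !W_row'.
by move/eqp_trans; apply; apply: sign_eqp.
Qed.

Let prod_dvd_det j0 : \prod_j h (lift j0 j) %| R * \det (W j0).
Proof.
rewrite mulr_sumr; apply: (big_ind (fun q => _ %| q)) => [|p q|s _].
- exact: dvdp0.
- exact: dvdp_add.
rewrite mulrCA dvdp_mull //; apply: dvdp_trans (R_dvd j0 s) _.
by rewrite dvdp_mul // (eq_bigr _ (fun j _ => mxE _ _ j (s j))) dvdpp.
Qed.

Lemma minimal_relation_degp j0 : (degp (h j0) + 'C(k, 2) <= degp R)%N.
Proof.
have all_dvd : \prod_j h j %| R * \det (W j0).
  apply: (coprime_family_dvd h_coprime) => j.
  rewrite (bigD1_ord j) //= dvdp_mul2l ?h_neq0 //.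
  by apply: dvdp_trans (prod_dvd_det j) _;
    rewrite dvdp_mul2l // (eqp_dvdl _ (det_eqp j j0)).
have := dvdp_degp (mulf_neq0 R_neq0 (det_neq0 j0)) all_dvd.
rewrite degpM // degp_prod // (bigD1_ord j0) //= => deg_le.
have W_le := degp_det_wronskian (det_neq0 j0).
move: W_le deg_le; rewrite -/(W j0).
move: (degp _) (degp _) (degp _) (\sum_i _)%N => a b c d; lia.
Qed.

End MasonStothers.

Section LogDerivative.

Variable F : fieldType.
Implicit Types (p q rho : {poly F}).

Definition clears_logderiv rho p := p %| rho * p^`().

Lemma clears_logderiv_derivn rho p l :
  clears_logderiv rho p -> p %| rho ^+ l * p^`(l).
Proof.
move=> rho_p; elim: l => [|l IHl]; first by rewrite mul1r derivn0.
have p_dvd : p %| rho * (rho ^+ l * p^`(l))^`().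
  have [u ->] := dvdpP _ _ IHl.
  rewrite derivM mulrDr dvdp_add //; first by rewrite mulrA dvdp_mull.
  by rewrite mulrCA dvdp_mull.
have -> : rho ^+ l.+1 * p^`(l.+1) =
    rho * (rho ^+ l * p^`(l))^`() - rho^`() *+ l * (rho ^+ l * p^`(l)).
  rewrite derivM -derivnS deriv_exp exprS.
  by case: l {IHl p_dvd} => [|l]; rewrite ?mulr0n ?exprS /=; ring.
by rewrite dvdp_sub // dvdp_mull.
Qed.

Lemma clears_logderiv_exp p m : clears_logderiv p (p ^+ m).
Proof.
rewrite /clears_logderiv deriv_exp; case: m => [|m]; first exact: dvd1p.
by rewrite mulrnAr mulrCA -exprS -mulrnAl dvdp_mull.
Qed.

Lemma clears_logderivM rho1 rho2 p q :
  clears_logderiv rho1 p -> clears_logderiv rho2 q ->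
  clears_logderiv (rho1 * rho2) (p * q).
Proof.
move=> rho_p rho_q; rewrite /clears_logderiv derivM mulrDr dvdp_add //.
  by rewrite mulrACA dvdp_mul // dvdp_mull.
by rewrite mulrACA dvdp_mul // dvdp_mull.
Qed.

Lemma clears_logderiv_prod (I : Type) (s : seq I) (p rho : I -> {poly F}) :
    (forall i, clears_logderiv (rho i) (p i)) ->
  clears_logderiv (\prod_(i <- s) rho i) (\prod_(i <- s) p i).
Proof.
move=> rho_p; elim/big_rec2: _ => [|i q r _ IH]; first exact: dvd1p.
exact: clears_logderivM.
Qed.

Lemma clears_logderivZ rho p a :
  a != 0 -> clears_logderiv rho p -> clears_logderiv rho (a *: p).
Proof.
by move=> a_neq0; rewrite /clears_logderiv derivZ -scalerAr dvdpZl // dvdpZr.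
Qed.

End LogDerivative.

Section PolynomialRelations.

Variable F : fieldType.

Lemma minimal_relation_mulIr k (g h : 'I_k.+1 -> {poly F}) D :
    D != 0 -> (forall j, g j = h j * D) -> minimal_relation g ->
  minimal_relation h.
Proof.
move=> D_neq0 gE [sum0 ind]; split=> [|j0 c c_rel].
  apply: (mulIf D_neq0); rewrite mul0r mulr_suml -[RHS]sum0.
  by apply: eq_bigr => j _; rewrite gE.
apply: (ind j0); transitivity ((\sum_j c j *: h (lift j0 j)) * D).
  by rewrite mulr_suml; apply: eq_bigr => j _; rewrite gE scalerAl.
by rewrite c_rel mul0r.
Qed.

Lemma coprime_familyZ (I : finType) (c : I -> F) (q : I -> {poly F}) :
    (forall i, c i != 0) -> coprime_family q ->
  coprime_family (fun i => c i *: q i).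
Proof.
move=> c_neq0 q_coprime p p_dvd; apply: q_coprime => i.
by rewrite -(dvdpZr _ _ (c_neq0 i)).
Qed.

Lemma dvdp_prod (I : Type) (s : seq I) (p q : I -> {poly F}) :
  (forall i, p i %| q i) -> \prod_(i <- s) p i %| \prod_(i <- s) q i.
Proof. by move=> pq; elim/big_rec2: _ => [|i r t _ rt]; rewrite ?dvdp_mul. Qed.

End PolynomialRelations.

(** * Independence of powers *)

Section PowerIndependence.

Variables (F : fieldType) (T d : nat).
Hypothesis charF : pchar_gt F T.

Lemma power_relation_degp k (c : 'I_k.+1 -> F) (q : 'I_k.+1 -> {poly F}) j0 :
    (forall j, c j != 0) -> (forall j, q j != 0) ->
    (forall j, size (q j ^+ d) <= T.+1)%N -> coprime_family q ->
    minimal_relation (fun j => c j *: q j ^+ d) ->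
  (degp (q j0) * d + 'C(k, 2) <= k.-1 * \sum_j degp (q j))%N.
Proof.
move=> c_neq0 q_neq0 q_size q_coprime rel.
pose R := \prod_j q j ^+ k.-1.
have qX_neq0 m j : q j ^+ m != 0 by rewrite expf_neq0.
have -> : (k.-1 * \sum_j degp (q j) = degp R)%N.
  rewrite degp_prod // big_distrr; apply: eq_bigr => j _.
  by rewrite degp_exp mulnC.
rewrite -degp_exp -(degpZ _ (c_neq0 j0)).
apply: (@minimal_relation_degp _ T _ (fun j => c j *: q j ^+ d)) => //.
- by move=> j; rewrite size_scale.
- by move=> j; rewrite scaler_eq0 negb_or c_neq0 qX_neq0.
- exact/coprime_familyZ/coprime_family_exp.
- exact/prodf_neq0.
move=> j1 s; rewrite /R (bigD1_ord j1) //= -mulrA dvdp_mull // -big_split.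
apply: dvdp_prod => j /=.
have le_s : (s j <= k.-1)%N by have := ltn_ord (s j); lia.
rewrite -(subnK le_s) exprD -mulrA dvdp_mull // clears_logderiv_derivn //.
exact/clears_logderivZ/clears_logderiv_exp.
Qed.

(* All degrees vanish as soon as [k ^ 2 <= d + 1]: compare with the largest. *)
Lemma power_relation_constant k (c : 'I_k.+1 -> F) (q : 'I_k.+1 -> {poly F}) :
    (0 < d)%N -> (k ^ 2 <= d + 1)%N ->
    (forall j, c j != 0) -> (forall j, q j != 0) ->
    (forall j, size (q j ^+ d) <= T.+1)%N -> coprime_family q ->
    minimal_relation (fun j => c j *: q j ^+ d) ->
  (k <= 1)%N /\ forall j, degp (q j) = 0%N.
Proof.
move=> d_gt0 le_kd c_neq0 q_neq0 q_size q_coprime rel.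
pose dq j := degp (q j).
have [m _ m_max] := arg_maxnP dq (erefl (xpredT (ord0 : 'I_k.+1))).
have degp_le := power_relation_degp m c_neq0 q_neq0 q_size q_coprime rel.
have sum_le : (\sum_j degp (q j) <= k.+1 * degp (q m))%N.
  by rewrite -[k.+1 in leqRHS]card_ord -sum_nat_const; apply: leq_sum => j _;
    apply: m_max.
have k_le1 : (k <= 1)%N.
  rewrite leqNgt -bin_gt0 -leqNgt -(leq_add2l (degp (q m) * d)) addn0.
  apply: leq_trans degp_le _; apply: leq_trans (leq_mul (leqnn _) sum_le) _.
  by rewrite mulnA mulnC leq_mul2l; case: (k) le_kd => [|k'] //=; nia.
split=> // j; apply/eqP; rewrite -leqn0; apply: leq_trans (m_max j isT) _.
rewrite -(leq_pmul2r d_gt0) mul0n.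
apply: leq_trans (leq_addr _ _) (leq_trans degp_le _).
by rewrite [k.-1](_ : _ = 0%N) //; case: (k) k_le1 => [|[]].
Qed.

Lemma power_lin_indep (I : finType) (f : I -> {poly F}) :
    (0 < d)%N -> ((#|I| - 1) ^ 2 <= d + 1)%N ->
    (forall i, size (f i ^+ d) <= T.+1)%N -> nonproportional f ->
  lin_indep (fun i => f i ^+ d).
Proof.
move=> d_gt0 le_Id f_size [f_neq0 f_nonprop]; apply: NNPP.
move=> /minimal_relation_exists [k [e [c [e_inj c_neq0 rel]]]].
have [D [q [D_neq0 fE q_coprime]]] :=
  @coprime_quotients _ _ (f \o e) ord0 (f_neq0 _).
have {}fE j : f (e j) = q j * D by apply: fE.
have q_neq0 j : q j != 0.
  by have := f_neq0 (e j); rewrite fE mulf_eq0 => /norP[].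
have q_size j : (size (q j ^+ d) <= T.+1)%N.
  apply: leq_trans (f_size (e j)); rewrite dvdp_leq ?expf_neq0 //.
  by rewrite fE exprMn dvdp_mulr.
have q_rel : minimal_relation (fun j => c j *: q j ^+ d).
  apply: (minimal_relation_mulIr (expf_neq0 d D_neq0)) rel => j.
  by rewrite fE exprMn scalerAl.
have lt_kI : (k < #|I|)%N by have := leq_card e e_inj; rewrite card_ord.
have le_kd : (k ^ 2 <= d + 1)%N by apply: leq_trans le_Id; rewrite leq_sqr; lia.
have [k_le1 q_const] :=
  power_relation_constant d_gt0 le_kd c_neq0 q_neq0 q_size q_coprime q_rel.
have {}q_const j : exists2 a, a != 0 & q j = a%:P.
  have /size1_polyC qE : (size (q j) <= 1)%N by rewrite -degp_leq q_const.
  by exists (q j)`_0; rewrite // -polyC_eq0 -qE.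
have [a a_neq0 qa] := q_const ord0; have [b b_neq0 qb] := q_const ord_max.
have /e_inj/(congr1 val) /= k0 : e ord0 = e ord_max.
  apply: (f_nonprop _ _ (a / b)).
  by rewrite !fE qa qb !mul_polyC scalerA divfK.
subst k; have /eqP := q_rel.1.
by rewrite big_ord1 scaler_eq0 (negPf (c_neq0 _)) expf_eq0 (negPf (q_neq0 _))
  andbF.
Qed.

End PowerIndependence.

(** * Restriction to a curve *)

Section ShiftedMonomials.

Variables (F : fieldType) (A : finType) (b : A -> F).
Hypothesis b_inj : injective b.

Definition shifted_monomial (u : A -> nat) : {poly F} :=
  \prod_a ('X - (b a)%:P) ^+ u a.

Lemma shifted_monomial_neq0 u : shifted_monomial u != 0.
Proof. by apply/prodf_neq0 => a _; rewrite expf_neq0 // polyXsubC_eq0. Qed.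

Lemma shifted_monomialD u v :
  shifted_monomial (fun a => u a + v a)%N =
    shifted_monomial u * shifted_monomial v.
Proof. by rewrite -big_split; apply: eq_bigr => a _; rewrite exprD. Qed.

Lemma eq_shifted_monomial u v :
  u =1 v -> shifted_monomial u = shifted_monomial v.
Proof. by move=> eq_uv; apply: eq_bigr => a _; rewrite eq_uv. Qed.

Lemma degp_shifted_monomial u : degp (shifted_monomial u) = (\sum_a u a)%N.
Proof.
rewrite degp_prod => [|a]; last by rewrite expf_neq0 // polyXsubC_eq0.
by apply: eq_bigr => a _; rewrite degp_exp /degp size_XsubC mul1n.
Qed.

Lemma coprimep_shifted_monomial p u :
    (forall a, u a != 0%N -> coprimep p ('X - (b a)%:P)) ->
  coprimep p (shifted_monomial u).
Proof.
move=> p_coprime; rewrite /shifted_monomial;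
  elim/big_ind: _ => [|q r cq cr|a _].
- exact: coprimep1.
- by rewrite coprimepMr cq.
have [->|ua_neq0] := eqVneq (u a) 0%N; first by rewrite expr0 coprimep1.
exact/coprimep_expr/p_coprime.
Qed.

Lemma coprime_shifted_monomials (I : finType) (i0 : I) (u : I -> A -> nat) :
    (forall a, exists i, u i a = 0%N) ->
  coprime_family (fun i => shifted_monomial (u i)).
Proof.
move=> u_min p p_dvd; rewrite dvdp1 -coprimepp.
apply: coprimep_dvdl (p_dvd i0) _.
apply: coprimep_shifted_monomial => a _; have [i uia] := u_min a.
rewrite coprimep_sym; apply: coprimep_dvdl (p_dvd i) _.
apply: coprimep_shifted_monomial => a' ua'; apply: coprimep_XsubC2.
by rewrite subr_eq0 (inj_eq b_inj); apply: contraNneq ua' => ->; rewrite uia.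
Qed.

Lemma clears_logderiv_shifted_monomial u :
  clears_logderiv (\prod_a ('X - (b a)%:P)) (shifted_monomial u).
Proof. by apply: clears_logderiv_prod => a; apply: clears_logderiv_exp. Qed.

Section Relations.

Variables (T k : nat) (c : 'I_k.+1 -> F).
Hypothesis charF : pchar_gt F T.
Hypothesis c_neq0 : forall j, c j != 0.

Lemma coprime_shifted_monomial_relation (v : 'I_k.+1 -> A -> nat) j0 :
    (forall j, size (shifted_monomial (v j)) <= T.+1)%N ->
    (forall a, exists j, v j a = 0%N) ->
    minimal_relation (fun j => c j *: shifted_monomial (v j)) ->
  (\sum_a v j0 a <= (#|A| - 1) * 'C(k, 2))%N.
Proof.
move=> v_size v_min rel; pose rho : {poly F} := \prod_a ('X - (b a)%:P).
have rho_neq0 : rho != 0 by apply/prodf_neq0 => a _; rewrite polyXsubC_eq0.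
have degp_rho : degp rho = #|A|.
  rewrite degp_prod => [|a]; last by rewrite polyXsubC_eq0.
  by rewrite /degp; under eq_bigr do rewrite size_XsubC; rewrite sum1_card.
rewrite mulnBl mul1n -[leqLHS](addnK 'C(k, 2)) leq_sub2r //.
rewrite -degp_shifted_monomial -(degpZ _ (c_neq0 j0)) -degp_rho -degp_exp.
apply: (minimal_relation_degp charF _ _ rel) => [j|j|||j1 s].
- by rewrite size_scale.
- by rewrite scaler_eq0 negb_or c_neq0 shifted_monomial_neq0.
- exact/coprime_familyZ/(coprime_shifted_monomials j0).
- by rewrite expf_neq0.
rewrite -(sum_perm_ord s) expr_sum -big_split; apply: dvdp_prod => j /=.
apply/clears_logderiv_derivn/clears_logderivZ => //.
exact: clears_logderiv_shifted_monomial.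
Qed.

(* After removal of the common factor, every exponent is at most the degree
   bound for the relation. *)
Lemma shifted_monomial_relation (u : 'I_k.+1 -> A -> nat) :
    (forall j, size (shifted_monomial (u j)) <= T.+1)%N ->
    minimal_relation (fun j => c j *: shifted_monomial (u j)) ->
  forall j l a, (u j a - u l a <= (#|A| - 1) * 'C(k, 2))%N.
Proof.
move=> u_size rel j l a.
pose jm a := [arg min_(j < ord0) u j a]; pose mu a := u (jm a) a.
have mu_le i a' : (mu a' <= u i a')%N.
  by rewrite /mu /jm; case: arg_minnP => // i' _; apply.
pose v i a' := (u i a' - mu a')%N.
have uE i :
    shifted_monomial (u i) = shifted_monomial (v i) * shifted_monomial mu.
  rewrite -shifted_monomialD; apply: eq_shifted_monomial => a'.
  by rewrite subnK.
apply: leq_trans (leq_sub2l _ (mu_le l a)) _.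
apply: (@leq_trans (\sum_a v j a)); first by rewrite (bigD1 a) //= leq_addr.
apply: coprime_shifted_monomial_relation.
- move=> i; apply: leq_trans (u_size i).
  rewrite dvdp_leq ?shifted_monomial_neq0 //.
  by rewrite uE dvdp_mulr.
- by move=> a'; exists (jm a'); rewrite /v subnn.
apply: (minimal_relation_mulIr (shifted_monomial_neq0 mu)) rel => i.
by rewrite uE scalerAl.
Qed.

End Relations.

End ShiftedMonomials.

Lemma lin_indep_XsubC_exp (F : fieldType) (I : finType) (b : F) (m : I -> nat) :
  injective m -> lin_indep (fun i => ('X - b%:P) ^+ m i).
Proof.
move=> m_inj c c_rel i.
have := congr1 (fun p => (p \Po ('X + b%:P))`_(m i)) c_rel.
rewrite comp_poly0 coef0 raddf_sum coef_sum (bigD1 i) //= big1 => [|j ne_ji].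
  rewrite addr0 comp_polyZ rmorphXn /= raddfB /= comp_polyX comp_polyC addrK.
  by rewrite coefZ coefXn eqxx mulr1.
rewrite comp_polyZ rmorphXn /= raddfB /= comp_polyX comp_polyC addrK.
by rewrite coefZ coefXn (inj_eq m_inj) eq_sym (negPf ne_ji) mulr0.
Qed.

Section Curve.

Variables (F : fieldType) (n' i : nat).
Let n := n'.+1.
Variable b : 'I_n -> F.

Definition curve_weight (a : 'I_n) : nat := if a == ord0 then 1%N else i.

Definition curve (a : 'I_n) : {poly F} := ('X - (b a)%:P) ^+ curve_weight a.

Definition restrict : {mpoly F[n]} -> {poly F} := mmap polyC curve.

HB.instance Definition _ := GRing.RMorphism.copy restrict (mmap polyC curve).

Let restrict_scalable : scalable restrict.
Proof. by move=> a f; rewrite /restrict mmapZ mul_polyC. Qed.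

HB.instance Definition _ :=
  GRing.isScalable.Build F {mpoly F[n]} {poly F} *:%R restrict
    restrict_scalable.

Definition curve_exponent (m : 'X_{1..n}) (a : 'I_n) : nat :=
  (curve_weight a * m a)%N.

Definition curve_monomial (m : 'X_{1..n}) : {poly F} :=
  shifted_monomial b (curve_exponent m).

Lemma restrictE f : restrict f = \sum_(m <- msupp f) f@_m *: curve_monomial m.
Proof.
rewrite /restrict /mmap; apply: eq_bigr => m _; rewrite mul_polyC;
  congr (_ *: _).
by apply: eq_bigr => a _; rewrite /curve -exprM.
Qed.

Hypothesis i_gt0 : (0 < i)%N.

Lemma size_curve_monomial m : (size (curve_monomial m) <= (mdeg m * i).+1)%N.
Proof.
rewrite -degp_leq degp_shifted_monomial mdegE big_distrl /=.
apply: leq_sum => a _.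
by rewrite /curve_exponent /curve_weight mulnC leq_mul2l; case: ifP;
  rewrite ?i_gt0 ?leqnn orbT.
Qed.

Lemma size_curve_monomial_supp (f : {mpoly F[n]}) delta m :
    (msize f <= delta.+1)%N -> m \in msupp f ->
  (size (curve_monomial m) <= (delta * i).+1)%N.
Proof.
move=> f_size /msize_mdeg_lt m_deg; apply: leq_trans (size_curve_monomial m) _.
by rewrite ltnS leq_mul2r -ltnS (leq_trans m_deg) ?orbT.
Qed.

Lemma size_restrict f delta :
  (msize f <= delta.+1)%N -> (size (restrict f) <= (delta * i).+1)%N.
Proof.
move=> f_size; rewrite restrictE; apply: leq_trans (size_sum _ _ _) _.
apply/bigmax_leqP_seq => m m_f _; apply: leq_trans (size_scale_leq _ _) _.
exact: size_curve_monomial_supp f_size m_f.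
Qed.

Hypothesis b_inj : injective b.

Section CurveRelation.

Variables (T k : nat) (c : 'I_k.+1 -> F) (m : 'I_k.+1 -> 'X_{1..n}).
Hypothesis charF : pchar_gt F T.
Hypothesis c_neq0 : forall j, c j != 0.
Hypothesis m_size : forall j, (size (curve_monomial (m j)) <= T.+1)%N.
Hypothesis m_rel : minimal_relation (fun j => c j *: curve_monomial (m j)).
Hypothesis k_small : (n' * 'C(k, 2) < i)%N.

Lemma curve_relation_agree j l a : a != ord0 -> m j a = m l a.
Proof.
move=> a_neq0; wlog suff le_m : j l / (m j a <= m l a)%N.
  by apply/eqP; rewrite eqn_leq !le_m.
have := shifted_monomial_relation b_inj charF c_neq0 m_size m_rel j l a.
rewrite card_ord subn1 /curve_exponent /curve_weight (negPf a_neq0)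
  -mulnBr => le_i.
have := leq_ltn_trans le_i k_small.
by rewrite -{2}[i]muln1 ltn_mul2l i_gt0 ltnS leqn0 subn_eq0.
Qed.

(* The monomials of a relation differ in the power of one linear form only. *)
Lemma curve_relation_not_injective : ~ injective m.
Proof.
move=> m_inj; pose z := 'X - (b ord0)%:P.
pose K :=
  \prod_(a < n | a != ord0) ('X - (b a)%:P) ^+ curve_exponent (m ord0) a.
have K_neq0 : K != 0.
  by apply/prodf_neq0 => a _; rewrite expf_neq0 // polyXsubC_eq0.
have mE j : curve_monomial (m j) = z ^+ m j ord0 * K.
  rewrite /curve_monomial /shifted_monomial (bigD1 ord0) //=; congr (_ * _).
    by rewrite /curve_exponent /curve_weight eqxx mul1n.
  apply: eq_bigr => a a_neq0; rewrite /curve_exponent.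
  by rewrite (curve_relation_agree j ord0 a_neq0).
have m0_inj : injective (fun j => m j ord0).
  move=> j l eq_m0; apply: m_inj; apply/mnmP => a.
  by have [->//|] := eqVneq a ord0; apply: curve_relation_agree.
have /eqP[] := c_neq0 ord0; apply: (lin_indep_XsubC_exp (b := b ord0) m0_inj).
apply: (mulIf K_neq0); rewrite mul0r mulr_suml -[RHS]m_rel.1.
by apply: eq_bigr => j _; rewrite mE scalerAl.
Qed.

End CurveRelation.

Lemma restrict_sparse_eq0 f delta t :
    pchar_gt F (delta * i) -> (msize f <= delta.+1)%N -> sparse t f ->
    (n' * 'C(t.-1, 2) < i)%N ->
  restrict f = 0 -> f = 0.
Proof.
move=> charF f_size f_sparse t_small rf0; apply/eqP/negPn/negP => f_neq0.
pose mon (x : 'I_(size (msupp f))) := tnth (in_tuple (msupp f)) x.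
have mon_f x : mon x \in msupp f by apply: mem_tnth.
have dep : ~ lin_indep (fun x => curve_monomial (mon x)).
  move=> ind.
  have x0 : 'I_(size (msupp f)) by exists 0%N; rewrite lt0n size_eq0 msupp_eq0.
  have /(_ x0)/eqP : forall x, f@_(mon x) = 0.
    apply: (ind (fun x => f@_(mon x))).
    by rewrite -[RHS]rf0 restrictE [RHS]big_tnth.
  by rewrite mcoeff_eq0 mon_f.
have [k [e [c [e_inj c_neq0 rel]]]] := minimal_relation_exists dep.
apply: (curve_relation_not_injective charF c_neq0 _ rel).
- by move=> j; apply: size_curve_monomial_supp f_size _.
- apply: leq_ltn_trans t_small; rewrite leq_mul2l leq_bin2l ?orbT //.
  have := leq_card e e_inj; rewrite !card_ord.
  by move: f_sparse; rewrite /sparse; lia.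
- apply: inj_comp e_inj => x y /eqP.
  by rewrite /mon !(tnth_nth 0%MM) nth_uniq ?msupp_uniq // => /eqP/val_inj.
Qed.

End Curve.

Definition curve_degree (r s n : nat) : nat := (r * s ^ 2 * n)%N.

Lemma bin2_lt_curve_degree q r s n' :
    (0 < q <= 2)%N -> (q <= r)%N -> (0 < s)%N ->
  (n' * 'C((q * s).-1, 2) < curve_degree r s n'.+1)%N.
Proof.
move=> /andP[q_gt0 q_le2] le_qr s_gt0.
have bin_le : ('C((q * s).-1, 2) <= r * s ^ 2)%N.
  rewrite -(leq_pmul2l (isT : 0 < 2)%N) -(mul_bin_diag _ 1) bin1.
  by nia.
rewrite /curve_degree mulnS; apply: leq_ltn_trans (leq_mul (leqnn _) bin_le) _.
by rewrite mulnC -[ltnLHS]add0n ltn_add2r muln_gt0 expn_gt0 s_gt0 andbT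
  (leq_trans q_gt0).
Qed.

Lemma sparseD (F : fieldType) n s t (f g : {mpoly F[n]}) :
  sparse s f -> sparse t g -> sparse (s + t) (f + g).
Proof.
move=> sf sg; apply: leq_trans (leq_add sf sg); rewrite -size_cat.
by apply: uniq_leq_size; [exact: msupp_uniq|exact: msuppD_le].
Qed.

Lemma sparseZ (F : fieldType) n s a (f : {mpoly F[n]}) :
  sparse s f -> sparse s (a *: f).
Proof.
by apply: leq_trans; apply: uniq_leq_size; [exact: msupp_uniq|exact: msuppZ_le].
Qed.

Section RestrictCircuit.

Variables (F : fieldType) (n' i s delta : nat) (b : 'I_n'.+1 -> F).
Hypothesis b_inj : injective b.
Hypothesis i_gt0 : (0 < i)%N.

Lemma nonproportional_restrict (I : finType) (h : I -> {mpoly F[n'.+1]}) :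
    pchar_gt F (delta * i) ->
    (forall x, sparse s (h x) /\ (msize (h x) <= delta.+1)%N) ->
    (n' * 'C(s.-1, 2) < i)%N ->
    ((1 < #|I|)%N -> (n' * 'C((2 * s).-1, 2) < i)%N) ->
    nonproportional h ->
  nonproportional (fun x => restrict i b (h x)).
Proof.
move=> charF h_sparse one_small two_small [h_neq0 h_nonprop].
split=> [x|x y a rxy].
  have [sx dx] := h_sparse x; apply: contra_neq (h_neq0 x).
  exact: restrict_sparse_eq0 charF dx sx one_small.
have [//|ne_xy] := eqVneq x y; apply: (h_nonprop x y a).
have [[sx dx] [sy dy]] := (h_sparse x, h_sparse y).
apply/eqP; rewrite -subr_eq0 -scaleNr; apply/eqP.
apply: (restrict_sparse_eq0 i_gt0 b_inj charF (t := 2 * s)).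
- apply: leq_trans (msizeD_le _ _) _; rewrite geq_max dx.
  exact: leq_trans (msizeZ_le _ _) dy.
- by rewrite mul2n -addnn; apply/sparseD/sparseZ.
- by apply: two_small; apply/card_gt1P; exists x, y.
- by rewrite rmorphD /= linearZ /= rxy scaleNr subrr.
Qed.

Lemma size_restrict_exp d (h : {mpoly F[n'.+1]}) :
  (msize h <= delta.+1)%N ->
    (size (restrict i b h ^+ d) <= (d * delta * i).+1)%N.
Proof.
move=> /(size_restrict b i_gt0); rewrite -!degp_leq degp_exp => le_h.
by rewrite -mulnA mulnC leq_mul2l le_h orbT.
Qed.

Lemma size_restrict_sum_pow r d f :
  sum_pow_sparse r d s delta f ->
    (size (restrict i b f) <= (d * delta * i).+1)%N.
Proof.
move=> [c [g [g_sparse ->]]]; rewrite raddf_sum.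
apply: leq_trans (size_sum _ _ _) _.
apply/bigmax_leqP => j _ /=; rewrite linearZ /= rmorphXn /=.
by apply: leq_trans (size_scale_leq _ _) (size_restrict_exp _ (g_sparse j).2).
Qed.

End RestrictCircuit.

Lemma restrict_sum_pow_neq0 (F : fieldType) n' r s d delta (b : 'I_n'.+1 -> F)
    (f : {mpoly F[n'.+1]}) (i := curve_degree r s n'.+1) :
    injective b -> (0 < r)%N -> (0 < s)%N -> (0 < d)%N ->
    ((r - 1) ^ 2 <= d + 1)%N -> pchar_gt F (d * delta * i) ->
    f != 0 -> sum_pow_sparse r d s delta f ->
  restrict i b f != 0.
Proof.
move=> b_inj r_gt0 s_gt0 d_gt0 le_rd charF f_neq0 [c0 [g0 [g0_sparse fE]]].
have i_gt0 : (0 < i)%N by rewrite !muln_gt0 r_gt0 s_gt0.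
have [r' [e [c [le_r' h_nonprop hE]]]] := sum_pow_nonproportional d_gt0 c0 g0.
rewrite hE in fE; set h := g0 \o e in h_nonprop; rewrite -/(h _) in fE.
have h_sparse j : sparse s (h j) /\ (msize (h j) <= delta.+1)%N.
  exact: g0_sparse.
have charF' : pchar_gt F (delta * i).
  by apply: (pchar_gt_leq charF); rewrite leq_mul2r leq_pmull ?orbT.
have rh_nonprop : nonproportional (fun j => restrict i b (h j)).
  apply: (nonproportional_restrict b_inj i_gt0 charF' h_sparse) h_nonprop.
    by have := @bin2_lt_curve_degree 1 r s n' isT r_gt0 s_gt0; rewrite mul1n.
  rewrite card_ord => lt1r'; apply: bin2_lt_curve_degree => //.
  exact: leq_trans lt1r' le_r'.
have ind : lin_indep (fun j => restrict i b (h j) ^+ d).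
  apply: (power_lin_indep charF d_gt0 _ _ rh_nonprop).
    by apply: leq_trans le_rd; rewrite card_ord leq_sqr leq_sub2r.
  by move=> j; apply: size_restrict_exp (h_sparse j).2.
apply: contraNneq f_neq0 => rf0; rewrite fE big1 // => j _.
rewrite (ind c) ?scale0r // -[RHS]rf0 fE raddf_sum; apply: eq_bigr => l _ /=.
by rewrite linearZ /= rmorphXn.
Qed.

(** * Polynomial-time programs *)

Fixpoint tsize (F : fieldType) (A : ty) : den F A -> nat :=
  match A return den F A -> nat with
  | TNat => fun m => m
  | TFld => fun _ => 0%N
  | TProd A B => fun x => (tsize x.1 + tsize x.2)%N
  | TList A => fun l => sumn [seq (tsize x).+1 | x <- l]
  end.

Fixpoint esize (F : fieldType) (G : seq ty) : env F G -> nat :=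
  match G return env F G -> nat with
  | [::] => fun _ => 0%N
  | A :: G => fun e => (tsize e.1 + esize e.2)%N
  end.

Definition poly_bounded G (phi : forall F, env F G -> nat) : Prop :=
  exists c, forall F e, (phi F e <= (esize e).+2 ^ c)%N.

Definition polytime G A (f : forall F, env F G -> den F A) : Prop :=
  exists t : tm G A, [/\ forall F e, eval t e = f F e,
    poly_bounded (fun F (e : env F G) => cost t e) &
    poly_bounded (fun F e => tsize (f F e))].

Definition polytimeb G (p : forall F, env F G -> bool) : Prop :=
  polytime (A := TNat) (fun F e => nat_of_bool (p F e)).

Section PolyBounded.

Variable G : seq ty.
Implicit Types phi psi : forall F, env F G -> nat.

Lemma poly_bounded_leq phi psi :
  (forall F e, (phi F e <= psi F e)%N) -> poly_bounded psi -> poly_bounded phi.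
Proof.
by move=> le_phi [c psi_c]; exists c => F e; apply: leq_trans (psi_c F e).
Qed.

Lemma poly_bounded_const k : poly_bounded (fun F (_ : env F G) => k).
Proof.
exists k => F e; apply: leq_trans (ltnW (ltn_expl k (ltnSn 1))) _.
by case: k => // k; rewrite leq_exp2r.
Qed.

Lemma poly_bounded_esize : poly_bounded (fun F (e : env F G) => esize e).
Proof. by exists 1%N => F e; rewrite expn1 ltnW // ltnW. Qed.

Lemma poly_boundedM phi psi : poly_bounded phi -> poly_bounded psi ->
  poly_bounded (fun F e => phi F e * psi F e)%N.
Proof.
by move=> [a phi_a] [b psi_b]; exists (a + b)%N => F e; rewrite expnD leq_mul.
Qed.

Lemma poly_boundedD phi psi : poly_bounded phi -> poly_bounded psi ->
  poly_bounded (fun F e => phi F e + psi F e)%N.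
Proof.
move=> [a phi_a] [b psi_b]; exists (a + b).+1 => F e.
have le_phi : (phi F e <= (esize e).+2 ^ (a + b))%N.
  by apply: leq_trans (phi_a F e) _; rewrite leq_pexp2l ?leq_addr.
have le_psi : (psi F e <= (esize e).+2 ^ (a + b))%N.
  by apply: leq_trans (psi_b F e) _; rewrite leq_pexp2l ?leq_addl.
apply: leq_trans (leq_add le_phi le_psi) _.
by rewrite addnn -mul2n expnS leq_mul2r ltnS ltnS leq0n orbT.
Qed.

Lemma poly_boundedS phi : poly_bounded phi ->
  poly_bounded (fun F e => (phi F e).+1).
Proof.
move=> phi_bd.
apply: poly_bounded_leq (poly_boundedD phi_bd (poly_bounded_const 1)).
by move=> F e; rewrite addn1.
Qed.

Lemma poly_boundedX phi c : poly_bounded phi ->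
  poly_bounded (fun F e => phi F e ^ c)%N.
Proof.
move=> phi_bd; elim: c => [|c IHc]; first exact: poly_bounded_const.
by apply: poly_bounded_leq (poly_boundedM phi_bd IHc) => F e; rewrite expnS.
Qed.

Lemma poly_bounded_env G' (chi : forall F, env F G' -> nat) psi :
    poly_bounded chi -> poly_bounded psi ->
  exists2 phi, poly_bounded phi &
    forall F e (e' : env F G'), (esize e' <= psi F e)%N ->
      (chi F e' <= phi F e)%N.
Proof.
move=> [c chi_c] psi_bd; exists (fun F e => (psi F e).+2 ^ c)%N.
  exact/poly_boundedX/poly_boundedS/poly_boundedS.
move=> F e e' le_e'; apply: leq_trans (chi_c F e') _.
by case: (c) => // c'; rewrite leq_exp2r // !ltnS.
Qed.

Lemma poly_bounded_comp G' (chi : forall F, env F G' -> nat)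
    (rho : forall F, env F G -> env F G') psi :
    poly_bounded chi -> (forall F e, (esize (rho F e) <= psi F e)%N) ->
  poly_bounded psi -> poly_bounded (fun F e => chi F (rho F e)).
Proof.
move=> chi_bd rho_le psi_bd.
have [phi phi_bd chi_le] := poly_bounded_env chi_bd psi_bd.
by apply: poly_bounded_leq phi_bd => F e; apply: chi_le.
Qed.

End PolyBounded.

Definition ren G G' := forall A, var G A -> var G' A.

Definition lift_ren G G' (r : ren G G') C : ren (C :: G) (C :: G') :=
  fun A v =>
  match v in var D A return
    (if D is C' :: D' then ren D' G' -> var (C' :: G') A else unit) with
  | VZ _ _ => fun _ => VZ _ _
  | VS _ _ _ v => fun r => VS _ (r _ v)
  end r.

Arguments lift_ren [G G'] r C A v.

Fixpoint rename G A (t : tm G A) : forall G', ren G G' -> tm G' A :=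
  match t in tm G A return forall G', ren G G' -> tm G' A with
  | Var _ _ v => fun _ r => Var (r _ v)
  | Let _ _ _ t u => fun _ r => Let (rename t r) (rename u (lift_ren r _))
  | Pair _ _ _ t u => fun _ r => Pair (rename t r) (rename u r)
  | Fst _ _ _ t => fun _ r => Fst (rename t r)
  | Snd _ _ _ t => fun _ r => Snd (rename t r)
  | Zero _ => fun _ _ => Zero _
  | Succ _ t => fun _ r => Succ (rename t r)
  | NatCase _ _ t u w => fun _ r =>
      NatCase (rename t r) (rename u r) (rename w (lift_ren r _))
  | NatRec _ _ t u w => fun _ r =>
      NatRec (rename t r) (rename u r) (rename w (lift_ren (lift_ren r _) _))
  | Nil _ _ => fun _ _ => Nil _ _
  | Cons _ _ t u => fun _ r => Cons (rename t r) (rename u r)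
  | ListCase _ _ _ t u w => fun _ r =>
      ListCase (rename t r) (rename u r) (rename w (lift_ren (lift_ren r _) _))
  | ListRec _ _ _ t u w => fun _ r =>
      ListRec (rename t r) (rename u r) (rename w (lift_ren (lift_ren r _) _))
  | FZero _ => fun _ _ => FZero _
  | FOne _ => fun _ _ => FOne _
  | FAdd _ t u => fun _ r => FAdd (rename t r) (rename u r)
  | FOpp _ t => fun _ r => FOpp (rename t r)
  | FMul _ t u => fun _ r => FMul (rename t r) (rename u r)
  | FInv _ t => fun _ r => FInv (rename t r)
  | FIfEq _ _ t u v w => fun _ r =>
      FIfEq (rename t r) (rename u r) (rename v r) (rename w r)
  end.

Definition renames F G G' (r : ren G G') (e' : env F G') (e : env F G) :=
  forall A (v : var G A), lookup (r A v) e' = lookup v e.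

Lemma renames_lift F G G' (r : ren G G') (e' : env F G') (e : env F G) C
    (x : den F C) :
  renames r e' e -> @renames F (C :: G) (C :: G') (lift_ren r C) (x, e') (x, e).
Proof.
move=> h A v.
refine (match v in var D B return
  match D return var D B -> Prop with
  | [::] => fun=> True
  | C' :: D' => fun v => forall (r : ren D' G') (e : env F D') (x : den F C'),
      renames r e' e ->
      lookup (lift_ren r C' _ v) ((x, e') : env F (C' :: G')) =
      lookup v ((x, e) : env F (C' :: D'))
  end v with VZ _ _ => _ | VS _ _ _ v => _ end r e x h) => // r0 e0 x0 h0 /=.
exact: h0.
Qed.

Lemma eq_foldr (X B : Type) (f f' : X -> B -> B) b l :
  (forall x y, f x y = f' x y) -> foldr f b l = foldr f' b l.
Proof. by move=> ef; elim: l => //= x l ->. Qed.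

Lemma eq_foldr_cost (X B : Type) (f f' : X -> B -> B)
    (c c' : X -> B -> nat) b l :
    (forall x y, f x y = f' x y) -> (forall x y, c x y = c' x y) ->
  foldr_cost f c b l = foldr_cost f' c' b l.
Proof.
move=> ef ec; elim: l => //= x l ->.
by rewrite ec; congr (c' _ _ + _)%N; apply: eq_foldr.
Qed.

Lemma eval_rename F G A (t : tm G A) G' (r : ren G G') (e' : env F G')
    (e : env F G) :
  renames r e' e -> eval (rename t r) e' = eval t e.
Proof.
elim: t G' r e' e => //=
  [? ? ? t IHt u IHu|? ? ? t IHt u IHu|? ? ? t IHt|? ? ? t IHt|? t IHt
  |? ? t IHt u IHu w IHw|? ? t IHt u IHu w IHw|? ? t IHt u IHu
  |? ? ? t IHt u IHu w IHw|? ? ? t IHt u IHu w IHw|? t IHt u IHu|? t IHt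
  |? t IHt u IHu|? t IHt|? ? t IHt u IHu v IHv w IHw] G' r e' e h;
  rewrite ?(IHt _ r e' e h) ?(IHu _ r e' e h) ?(IHv _ r e' e h)
    ?(IHw _ r e' e h) //.
- by apply: IHu; apply: renames_lift.
- by case: (eval t e) => // k; apply: IHw; apply: renames_lift.
- by apply: eq_iteri => k x; apply: IHw; do 2!apply: renames_lift.
- by case: (eval t e) => // x l; apply: IHw; do 2!apply: renames_lift.
- by apply: eq_foldr => // x y; apply: IHw; do 2!apply: renames_lift.
Qed.

Lemma cost_rename F G A (t : tm G A) G' (r : ren G G') (e' : env F G')
    (e : env F G) :
  renames r e' e -> cost (rename t r) e' = cost t e.
Proof.
elim: t G' r e' e => //=
  [? ? ? t IHt u IHu|? ? ? t IHt u IHu|? ? ? t IHt|? ? ? t IHt|? t IHt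
  |? ? t IHt u IHu w IHw|G0 A0 t IHt u IHu w IHw|? ? t IHt u IHu
  |? ? ? t IHt u IHu w IHw|? ? ? t IHt u IHu w IHw|? t IHt u IHu|? t IHt
  |? t IHt u IHu|? t IHt|? ? t IHt u IHu v IHv w IHw] G' r e' e h;
  rewrite ?(IHt _ r e' e h) ?(IHu _ r e' e h) ?(IHv _ r e' e h)
    ?(IHw _ r e' e h)
    ?(eval_rename t h) ?(eval_rename u h) //; congr (_ + _).+1.
- by apply: IHu; apply: renames_lift.
- by case: (eval t e) => // k; apply: IHw; apply: renames_lift.
- apply: eq_bigr => k _.
  have -> : iteri k (fun j a => eval (rename w (lift_ren (lift_ren r A0) TNat))
      ((j, (a, e')) : env F (TNat :: A0 :: G'))) (eval u e) =
      iteri k (fun j a => eval w ((j, (a, e)) : env F (TNat :: A0 :: G0)))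
        (eval u e).
    by apply: eq_iteri => j x; apply: eval_rename; do 2!apply: renames_lift.
  by apply: IHw; do 2!apply: renames_lift.
- by case: (eval t e) => // x l; apply: IHw; do 2!apply: renames_lift.
- apply: eq_foldr_cost => x y; last by apply: IHw; do 2!apply: renames_lift.
  by apply: eval_rename; do 2!apply: renames_lift.
Qed.

Lemma polytime_ext G A (f f' : forall F, env F G -> den F A) :
  (forall F e, f F e = f' F e) -> polytime f -> polytime f'.
Proof.
move=> eq_f [t [tE t_cost f_size]]; exists t; split=> // [F e|].
  by rewrite tE.
by apply: poly_bounded_leq f_size => F e; rewrite eq_f.
Qed.

Lemma polytime_tsize G A (f : forall F, env F G -> den F A) :
  polytime f -> poly_bounded (fun F e => tsize (f F e)).
Proof. by case=> t []. Qed.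

Lemma tsize_lookup F G A (v : var G A) (e : env F G) :
  (tsize (lookup v e) <= esize e)%N.
Proof.
by elim: v e => [G0 A0|G0 A0 B v IHv] [x e] /=; [lia | have := IHv e; lia].
Qed.

Lemma polytime_lookup G A (v : var G A) :
  polytime (fun F (e : env F G) => lookup v e).
Proof.
exists (Var v); split=> //; first exact: poly_bounded_const.
by apply: poly_bounded_leq (@poly_bounded_esize G) => F e; apply: tsize_lookup.
Qed.

Ltac polytime_var := first
  [ exact: (polytime_lookup (VZ _ _))
  | exact: (polytime_lookup (VS _ (VZ _ _)))
  | exact: (polytime_lookup (VS _ (VS _ (VZ _ _))))
  | exact: (polytime_lookup (VS _ (VS _ (VS _ (VZ _ _)))))
  | exact: (polytime_lookup (VS _ (VS _ (VS _ (VS _ (VZ _ _))))))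
  | exact: (polytime_lookup (VS _ (VS _ (VS _ (VS _ (VS _ (VZ _ _))))))) ].

Lemma polytime_rename G G' A (f : forall F, env F G -> den F A) (r : ren G G')
    (rho : forall F, env F G' -> env F G) :
    (forall F e, renames r e (rho F e)) ->
    (forall F e, (esize (rho F e) <= esize e)%N) ->
  polytime f -> polytime (fun F e => f F (rho F e)).
Proof.
move=> r_rho rho_le [t [tE t_cost f_size]]; exists (rename t r); split.
- by move=> F e; rewrite (eval_rename t (r_rho F e)).
- apply: poly_bounded_leq
    (poly_bounded_comp t_cost rho_le (@poly_bounded_esize G')).
  by move=> F e; rewrite (cost_rename t (r_rho F e)).
- exact: poly_bounded_comp f_size rho_le (@poly_bounded_esize G').
Qed.

Lemma polytime_wk G A B (f : forall F, env F G -> den F A) :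
  polytime f -> polytime (fun F (e : env F (B :: G)) => f F e.2).
Proof.
apply: (polytime_rename (r := fun A v => VS B v)) => // F e.
exact: leq_addl.
Qed.

Lemma polytime_wk2 G A B C (f : forall F, env F G -> den F A) :
  polytime f -> polytime (fun F (e : env F (C :: B :: G)) => f F e.2.2).
Proof. by move=> f_pt; apply: polytime_wk (polytime_wk B f_pt). Qed.

Lemma polytime_wk_under G A B C (f : forall F, env F (C :: G) -> den F A) :
  polytime f ->
  polytime (fun F (e : env F (C :: B :: G)) => f F (e.1, e.2.2)).
Proof.
apply: (@polytime_rename (C :: G) (C :: B :: G) A f
  (lift_ren (fun A v => VS B v) C) (fun F e => (e.1, e.2.2))) => F e.
  by case: e => x e; apply: renames_lift.
by rewrite /= leq_add2l leq_addl.
Qed.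

Lemma polytime_let G A B (f : forall F, env F G -> den F A)
    (g : forall F, env F (A :: G) -> den F B) :
  polytime f -> polytime g -> polytime (fun F e => g F (f F e, e)).
Proof.
move=> [t [tE t_cost f_size]] [u [uE u_cost g_size]].
pose rho F (e : env F G) : env F (A :: G) := (f F e, e).
have rho_bd : poly_bounded (fun F e => esize (rho F e)).
  exact: poly_boundedD (@poly_bounded_esize G).
exists (Let t u); split.
- by move=> F e /=; rewrite tE uE.
- have u_rho :=
    poly_bounded_comp u_cost (fun F e => leqnn (esize (rho F e))) rho_bd.
  apply: poly_bounded_leq (poly_boundedS (poly_boundedD t_cost u_rho)).
  by move=> F e /=; rewrite tE.
- exact: (poly_bounded_comp g_size (fun F e => leqnn (esize (rho F e))) rho_bd).
Qed.

Lemma polytime_app2 G A B C (f : forall F, den F A -> den F B -> den F C)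
    (x : forall F, env F G -> den F A) (y : forall F, env F G -> den F B) :
    polytime (fun F (e : env F (A :: B :: G)) => f F e.1 e.2.1) ->
    polytime x -> polytime y ->
  polytime (fun F e => f F (x F e) (y F e)).
Proof.
move=> f_pt x_pt y_pt; have := polytime_let (polytime_wk B x_pt) f_pt.
exact: (polytime_let y_pt).
Qed.

Lemma polytime_pair G A B (f : forall F, env F G -> den F A)
    (g : forall F, env F G -> den F B) :
  polytime f -> polytime g ->
  polytime (A := TProd A B) (fun F e => (f F e, g F e)).
Proof.
move=> [t [tE t_cost f_size]] [u [uE u_cost g_size]]; exists (Pair t u); split.
- by move=> F e /=; rewrite tE uE.
- exact/poly_boundedS/poly_boundedD.
- exact: poly_boundedD.
Qed.

Lemma polytime0 G : polytime (A := TNat) (fun F (_ : env F G) => 0%N).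
Proof. by exists (Zero G); split=> //; apply: poly_bounded_const. Qed.

Lemma polytimeS G (f : forall F, env F G -> den F TNat) :
  polytime f -> polytime (A := TNat) (fun F e => (f F e).+1).
Proof.
move=> [t [tE t_cost f_size]]; exists (Succ t); split; try exact/poly_boundedS.
by move=> F e /=; rewrite tE.
Qed.

Lemma polytime_nil G A : polytime (A := TList A) (fun F (_ : env F G) => [::]).
Proof. by exists (Nil G A); split=> //; apply: poly_bounded_const. Qed.

Lemma polytime_cons G A (f : forall F, env F G -> den F A)
    (g : forall F, env F G -> den F (TList A)) :
  polytime f -> polytime g ->
  polytime (A := TList A) (fun F e => f F e :: g F e).
Proof.
move=> [t [tE t_cost f_size]] [u [uE u_cost g_size]]; exists (Cons t u); split.
- by move=> F e /=; rewrite tE uE.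
- exact/poly_boundedS/poly_boundedD.
- by apply: poly_bounded_leq (poly_boundedS (poly_boundedD f_size g_size)).
Qed.

Lemma polytime_fld0 G : polytime (A := TFld) (fun F (_ : env F G) => 0 : F).
Proof. by exists (FZero G); split=> //; apply: poly_bounded_const. Qed.

Lemma polytime_fld1 G : polytime (A := TFld) (fun F (_ : env F G) => 1 : F).
Proof. by exists (FOne G); split=> //; apply: poly_bounded_const. Qed.

Lemma polytime_fldD G (f g : forall F, env F G -> den F TFld) :
  polytime f -> polytime g ->
  polytime (A := TFld) (fun F e => (f F e : F) + g F e).
Proof.
move=> [t [tE t_cost _]] [u [uE u_cost _]]; exists (FAdd t u); split.
- by move=> F e /=; rewrite tE uE.
- exact/poly_boundedS/poly_boundedD.
- exact: poly_bounded_const.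
Qed.

Lemma polytime_fldM G (f g : forall F, env F G -> den F TFld) :
  polytime f -> polytime g ->
  polytime (A := TFld) (fun F e => (f F e : F) * g F e).
Proof.
move=> [t [tE t_cost _]] [u [uE u_cost _]]; exists (FMul t u); split.
- by move=> F e /=; rewrite tE uE.
- exact/poly_boundedS/poly_boundedD.
- exact: poly_bounded_const.
Qed.

Lemma polytimeb_fld_eq G (f g : forall F, env F G -> den F TFld) :
  polytime f -> polytime g -> polytimeb (fun F e => (f F e : F) == g F e).
Proof.
move=> [t [tE t_cost _]] [u [uE u_cost _]].
exists (FIfEq t u (Succ (Zero G)) (Zero G)); split.
- by move=> F e /=; rewrite tE uE; case: eqP.
- apply: poly_bounded_leq
    (poly_boundedS (poly_boundedD (poly_boundedD t_cost u_cost)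
    (poly_bounded_const G 2))) => F e /=.
  by rewrite ltnS leq_add2l; case: ifP.
- by apply: poly_bounded_leq (poly_bounded_const G 1) => F e; case: eqP.
Qed.

Lemma polytime_natcase G A (m : forall F, env F G -> den F TNat)
    (f : forall F, env F G -> den F A)
    (g : forall F, env F (TNat :: G) -> den F A) :
  polytime m -> polytime f -> polytime g ->
  polytime (fun F e => if m F e is k.+1 then g F (k, e) else f F e).
Proof.
move=> [t [tE t_cost m_size]] [u [uE u_cost f_size]] [w [wE w_cost g_size]].
pose rho F (e : env F G) : env F (TNat :: G) := ((m F e).-1, e).
have rho_le F e : (esize (rho F e) <= tsize (m F e) + esize e)%N.
  by rewrite leq_add2r leq_pred.
have m_e_bd := poly_boundedD m_size (@poly_bounded_esize G).
exists (NatCase t u w); split.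
- by move=> F e /=; rewrite tE; case: (m F e).
- apply: poly_bounded_leq (poly_boundedS (poly_boundedD t_cost
    (poly_boundedD u_cost (poly_bounded_comp w_cost rho_le m_e_bd)))) => F e /=.
  rewrite tE ltnS leq_add2l /rho.
  by case: (m F e) => [|k]; rewrite ?leq_addr ?leq_addl.
- apply: poly_bounded_leq (poly_boundedD f_size
    (poly_bounded_comp g_size rho_le m_e_bd)) => F e.
  by rewrite /rho; case: (m F e) => [|k]; rewrite ?leq_addr ?leq_addl.
Qed.

Lemma polytime_listcase G A B (l : forall F, env F G -> den F (TList A))
    (f : forall F, env F G -> den F B)
    (g : forall F, env F (A :: TList A :: G) -> den F B) :
  polytime l -> polytime f -> polytime g ->
  polytime (fun F e => if l F e is x :: l' then g F (x, (l', e)) else f F e).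
Proof.
move=> [t [tE t_cost l_size]] [u [uE u_cost f_size]] [w [wE w_cost g_size]].
have l_e_bd := poly_boundedD l_size (@poly_bounded_esize G).
have [cost_w cost_w_bd w_le] := poly_bounded_env w_cost l_e_bd.
have [size_g size_g_bd g_le] := poly_bounded_env g_size l_e_bd.
have esize_cons F e x l' : l F e = x :: l' ->
    (esize ((x, (l', e)) : env F (A :: TList A :: G)) <=
     tsize (l F e) + esize e)%N.
  by move=> -> /=; lia.
exists (ListCase t u w); split.
- by move=> F e /=; rewrite tE; case: (l F e).
- apply: poly_bounded_leq (poly_boundedS (poly_boundedD t_cost
    (poly_boundedD u_cost cost_w_bd))) => F e /=.
  rewrite tE ltnS leq_add2l; case lE: (l F e) => [|x l']; first exact: leq_addr.
  exact: leq_trans (w_le _ _ _ (esize_cons _ _ _ _ lE)) (leq_addl _ _).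
- apply: poly_bounded_leq (poly_boundedD f_size size_g_bd) => F e.
  case lE: (l F e) => [|x l']; first exact: leq_addr.
  exact: leq_trans (g_le _ _ _ (esize_cons _ _ _ _ lE)) (leq_addl _ _).
Qed.

Lemma polytime_iteri G A (m : forall F, env F G -> den F TNat)
    (f : forall F, env F G -> den F A)
    (g : forall F, env F (TNat :: A :: G) -> den F A)
    (psi : forall F, env F G -> nat) :
    polytime m -> polytime f -> polytime g -> poly_bounded psi ->
    (forall F e k, (k <= m F e)%N ->
      (tsize (iteri k (fun j x => g F (j, (x, e))) (f F e)) <= psi F e)%N) ->
  polytime (fun F e => iteri (m F e) (fun j x => g F (j, (x, e))) (f F e)).
Proof.
move=> [t [tE t_cost m_size]] [u [uE u_cost f_size]] [w [wE w_cost g_size]]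
  psi_bd iter_le.
have [cost_w cost_w_bd w_le] := poly_bounded_env w_cost
  (poly_boundedD m_size (poly_boundedD psi_bd (@poly_bounded_esize G))).
have iterE F (e : env F G) k :
    iteri k (fun j x => eval w ((j, (x, e)) : env F (TNat :: A :: G))) (f F e) =
    iteri k (fun j x => g F (j, (x, e))) (f F e).
  by apply: eq_iteri => j x; rewrite wE.
exists (NatRec t u w); split.
- by move=> F e /=; rewrite tE uE iterE.
- apply: poly_bounded_leq
    (poly_boundedS (poly_boundedD (poly_boundedD t_cost u_cost)
    (poly_boundedM m_size cost_w_bd))) => F e /=.
  rewrite tE ltnS leq_add2l uE -[X in (_ <= X * _)%N]card_ord -sum_nat_const.
  apply: leq_sum => k _; rewrite iterE; apply: w_le.
  by rewrite /= leq_add ?leq_add2r ?iter_le // ltnW.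
- by apply: poly_bounded_leq psi_bd => F e; apply: iter_le.
Qed.

Lemma tsize_cat F A (l1 l2 : den F (TList A)) :
  tsize (A := TList A) (l1 ++ l2) =
  (tsize (A := TList A) l1 + tsize (A := TList A) l2)%N.
Proof. by rewrite /= map_cat sumn_cat. Qed.

Lemma foldr_cost_leq F A B (f : den F A -> den F B -> den F B)
    (c : den F A -> den F B -> nat) (b : den F B) (l : den F (TList A)) M :
    (forall l1 x l2, l = l1 ++ x :: l2 -> (c x (foldr f b l2) <= M)%N) ->
  (foldr_cost f c b l <= tsize (A := TList A) l * M)%N.
Proof.
elim: l => [//|x l IHl] c_le.
rewrite [foldr_cost _ _ _ _]/= [tsize _]/= mulnDl; apply: leq_add.
  by apply: leq_trans (c_le [::] x l erefl) _; rewrite mulSn leq_addr.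
by apply: IHl => l1 y l2 lE; apply: (c_le (x :: l1)); rewrite lE.
Qed.

Lemma polytime_foldr G A B (l : forall F, env F G -> den F (TList A))
    (f : forall F, env F G -> den F B)
    (g : forall F, env F (A :: B :: G) -> den F B)
    (psi : forall F, env F G -> nat) :
    polytime l -> polytime f -> polytime g -> poly_bounded psi ->
    (forall F e l1 l2, l F e = l1 ++ l2 ->
      (tsize (foldr (fun x y => g F (x, (y, e))) (f F e) l2) <= psi F e)%N) ->
  polytime (fun F e => foldr (fun x y => g F (x, (y, e))) (f F e) (l F e)).
Proof.
move=> [t [tE t_cost l_size]] [u [uE u_cost f_size]] [w [wE w_cost g_size]]
  psi_bd fold_le.
have [cost_w cost_w_bd w_le] := poly_bounded_env w_cost
  (poly_boundedD l_size (poly_boundedD psi_bd (@poly_bounded_esize G))).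
have foldE F (e : env F G) l' :
    foldr (fun x y => eval w ((x, (y, e)) : env F (A :: B :: G))) (f F e) l' =
    foldr (fun x y => g F (x, (y, e))) (f F e) l'.
  by apply: eq_foldr => x y; rewrite wE.
exists (ListRec t u w); split.
- by move=> F e /=; rewrite tE uE foldE.
- apply: poly_bounded_leq
    (poly_boundedS (poly_boundedD (poly_boundedD t_cost u_cost)
    (poly_boundedM l_size cost_w_bd))) => F e.
  rewrite [cost _ _]/= tE ltnS leq_add2l uE.
  apply: foldr_cost_leq => l1 x l2 lE.
  rewrite foldE; apply: w_le; rewrite [esize _]/= leq_add //.
    by rewrite lE tsize_cat /=; lia.
  by rewrite leq_add2r (fold_le _ _ (rcons l1 x)) // cat_rcons.
- by apply: poly_bounded_leq psi_bd => F e; apply: (fold_le F e [::]).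
Qed.

Lemma polytime_if G A (p : forall F, env F G -> bool)
    (f g : forall F, env F G -> den F A) :
  polytimeb p -> polytime f -> polytime g ->
  polytime (fun F e => if p F e then f F e else g F e).
Proof.
move=> p_pt f_pt g_pt.
apply: polytime_ext (polytime_natcase p_pt g_pt (polytime_wk TNat f_pt)) => F e.
by case: (p F e).
Qed.

Lemma polytimeb_neg G (p : forall F, env F G -> bool) :
  polytimeb p -> polytimeb (fun F e => ~~ p F e).
Proof.
move=> p_pt; apply: polytime_ext (polytime_if p_pt (polytime0 G)
  (polytimeS (polytime0 G))) => F e.
by case: (p F e).
Qed.

Lemma polytime_pred G (m : forall F, env F G -> den F TNat) :
  polytime m -> polytime (A := TNat) (fun F e => (m F e).-1).
Proof.
move=> m_pt; apply: polytime_ext (polytime_natcase m_pt (polytime0 G)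
  (polytime_lookup (VZ G TNat))) => F e.
by case: (m F e).
Qed.

Lemma polytime_iter G A (m : forall F, env F G -> den F TNat)
    (f : forall F, env F G -> den F A)
    (g : forall F, env F (A :: G) -> den F A)
    (psi : forall F, env F G -> nat) :
    polytime m -> polytime f -> polytime g -> poly_bounded psi ->
    (forall F e k, (k <= m F e)%N ->
      (tsize (iter k (fun x => g F (x, e)) (f F e)) <= psi F e)%N) ->
  polytime (fun F e => iter (m F e) (fun x => g F (x, e)) (f F e)).
Proof.
move=> m_pt f_pt g_pt psi_bd iter_le.
have iteriE F e k :
    iteri k (fun=> fun x => g F (x, e)) (f F e) =
      iter k (fun x => g F (x, e)) (f F e).
  by elim: k => //= k ->.
apply: polytime_ext
  (polytime_iteri m_pt f_pt (polytime_wk TNat g_pt) psi_bd _) => F e //.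
by move=> k le_k; rewrite iteriE iter_le.
Qed.

Lemma polytimeD G (m k : forall F, env F G -> den F TNat) :
  polytime m -> polytime k -> polytime (A := TNat) (fun F e => m F e + k F e)%N.
Proof.
move=> m_pt k_pt.
apply: polytime_ext (@polytime_iter G TNat k m (fun F e => e.1.+1)
  (fun F e => m F e + k F e)%N k_pt m_pt _ _ _) => [F e|||F e j le_j] /=.
- exact: iter_succn.
- by apply: polytimeS; polytime_var.
- exact: poly_boundedD (polytime_tsize m_pt) (polytime_tsize k_pt).
- by rewrite iter_succn leq_add2l.
Qed.

Lemma polytimeM G (m k : forall F, env F G -> den F TNat) :
  polytime m -> polytime k -> polytime (A := TNat) (fun F e => m F e * k F e)%N.
Proof.
move=> m_pt k_pt; apply: polytime_ext (@polytime_iter G TNat k (fun F e => 0%N)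
  (fun F e => m F e.2 + e.1)%N (fun F e => m F e * k F e)%N k_pt _ _ _ _)
  => [F e||||F e j le_j] /=.
- exact: iter_addn_0.
- exact: polytime0.
- by apply: polytimeD; [exact: polytime_wk | polytime_var].
- exact: poly_boundedM (polytime_tsize m_pt) (polytime_tsize k_pt).
- by rewrite iter_addn_0 leq_mul2l le_j orbT.
Qed.

Lemma polytimeB G (m k : forall F, env F G -> den F TNat) :
  polytime m -> polytime k -> polytime (A := TNat) (fun F e => m F e - k F e)%N.
Proof.
move=> m_pt k_pt.
apply: polytime_ext (@polytime_iter G TNat k m (fun F e => e.1.-1)
  m k_pt m_pt _ (polytime_tsize m_pt) _) => [F e||F e j le_j] /=.
- exact: iter_predn.
- by apply: polytime_pred; polytime_var.
- by rewrite iter_predn leq_subr.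
Qed.

Lemma polytimeb_leq G (m k : forall F, env F G -> den F TNat) :
  polytime m -> polytime k -> polytimeb (fun F e => m F e <= k F e)%N.
Proof.
move=> m_pt k_pt; apply: polytime_ext (polytime_natcase (polytimeB m_pt k_pt)
  (polytimeS (polytime0 G)) (polytime0 _)) => F e.
by rewrite /leq; case: (_ - _)%N.
Qed.

Lemma polytime_natr G (m : forall F, env F G -> den F TNat) :
  polytime m -> polytime (A := TFld) (fun F e => (m F e)%:R : F).
Proof.
move=> m_pt; apply: polytime_ext (@polytime_iter G TFld m (fun F e => 0)
  (fun F e => 1 + e.1) (fun F e => 0%N) m_pt _ _ _ _)
  => [F e||||F e j le_j] //=.
- exact: iter_addr_0.
- exact: polytime_fld0.
- by apply: polytime_fldD; [exact: polytime_fld1 | polytime_var].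
- exact: poly_bounded_const.
Qed.

Lemma polytime_sum G (m : forall F, env F G -> den F TNat)
    (f : forall F, env F (TNat :: G) -> den F TFld) :
    polytime m -> polytime f ->
  polytime (A := TFld)
    (fun F e => \sum_(j < m F e) (f F (nat_of_ord j, e) : F)).
Proof.
move=> m_pt f_pt.
apply: polytime_ext (@polytime_iteri G TFld m (fun F e => 0)
  (fun F e => e.2.1 + f F (e.1, e.2.2)) (fun F e => 0%N) m_pt _ _ _ _)
  => [F e||||F e k le_k] //.
- by elim: (m F e) => [|k IHk]; rewrite ?big_ord0 // big_ord_recr /= IHk.
- exact: polytime_fld0.
- by apply: polytime_fldD;
    [polytime_var | exact: (polytime_wk_under TFld f_pt)].
- exact: poly_bounded_const.
Qed.

Lemma size_leq_tsize F A (l : den F (TList A)) :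
  (size l <= tsize (A := TList A) l)%N.
Proof. by elim: l => //= x l; lia. Qed.

Lemma tsize_mem F A (l : den F (TList A)) :
  all (fun x => tsize x <= tsize (A := TList A) l)%N l.
Proof.
elim: l => //= x l IHl; apply/andP; split; first by lia.
by apply: sub_all IHl => y; rewrite /=; lia.
Qed.

Lemma tsize_map_leq F A (X : Type) (f : X -> den F A) (s : seq X) M :
  all (fun x => tsize (f x) <= M)%N s ->
  (tsize (A := TList A) [seq f x | x <- s] <= size s * M.+1)%N.
Proof.
elim: s => //= x s IHs /andP[le_fx /IHs le_s].
by rewrite mulSn leq_add.
Qed.

Lemma polytime_size G A (l : forall F, env F G -> den F (TList A)) :
  polytime l -> polytime (A := TNat) (fun F e => size (l F e)).
Proof.
move=> l_pt.
have foldE F (s : den F (TList A)) :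
    foldr (fun (_ : den F A) (y : nat) => y.+1) 0%N s = size s.
  by elim: s => //= x s ->.
apply: polytime_ext (@polytime_foldr G A TNat l (fun F e => 0%N)
  (fun F e => e.2.1.+1) (fun F e => tsize (A := TList A) (l F e)) l_pt _ _ _ _)
  => [F e||||F e l1 l2 lE].
- exact: foldE.
- exact: polytime0.
- by apply: polytimeS; polytime_var.
- exact: polytime_tsize l_pt.
- rewrite [in X in foldr X]/= foldE lE tsize_cat.
  exact: leq_trans (size_leq_tsize _) (leq_addl _ _).
Qed.

Lemma polytime_cat G A (l1 l2 : forall F, env F G -> den F (TList A)) :
  polytime l1 -> polytime l2 ->
  polytime (A := TList A) (fun F e => l1 F e ++ l2 F e).
Proof.
move=> l1_pt l2_pt.
have foldE F (s t : den F (TList A)) : foldr (fun x y => x :: y) t s = s ++ t.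
  by elim: s => //= x s ->.
apply: polytime_ext
  (@polytime_foldr G A (TList A) l1 l2 (fun F e => e.1 :: e.2.1)
  (fun F e => tsize (A := TList A) (l1 F e) + tsize (A := TList A) (l2 F e))%N
  l1_pt l2_pt _ _ _) => [F e|||F e s1 s2 sE].
- exact: foldE.
- by apply: polytime_cons; polytime_var.
- exact: poly_boundedD (polytime_tsize l1_pt) (polytime_tsize l2_pt).
- by rewrite [in X in foldr X]/= foldE sE !tsize_cat leq_add2r leq_addl.
Qed.

Lemma polytime_rcons G A (l : forall F, env F G -> den F (TList A))
    (x : forall F, env F G -> den F A) :
  polytime l -> polytime x ->
  polytime (A := TList A) (fun F e => rcons (l F e) (x F e)).
Proof.
move=> l_pt x_pt.
apply: polytime_ext
  (polytime_cat l_pt (polytime_cons x_pt (polytime_nil G A))) => F e.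
by rewrite cats1.
Qed.

Lemma polytime_map G A B (l : forall F, env F G -> den F (TList A))
    (f : forall F, env F (A :: G) -> den F B) :
  polytime l -> polytime f ->
  polytime (A := TList B) (fun F e => [seq f F (x, e) | x <- l F e]).
Proof.
move=> l_pt f_pt; have l_size := polytime_tsize l_pt.
have [phi phi_bd f_le] := poly_bounded_env (polytime_tsize f_pt)
  (poly_boundedD l_size (@poly_bounded_esize G)).
apply: (@polytime_foldr G A (TList B) l (fun F e => [::])
  (fun F e => f F (e.1, e.2.2) :: e.2.1)
  (fun F e => tsize (A := TList A) (l F e) * (phi F e).+1)%N l_pt) =>
    [|||F e l1 l2 lE].
- exact: polytime_nil.
- by apply: polytime_cons;
    [exact: (polytime_wk_under (TList B) f_pt) | polytime_var].
- exact/poly_boundedM/poly_boundedS.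
have map_le : (tsize (A := TList B) [seq f F (x, e) | x <- l2] <=
    size l2 * (phi F e).+1)%N.
  apply: tsize_map_leq; have := tsize_mem (l F e);
    rewrite lE all_cat => /andP[_].
  by apply: sub_all => x le_x; apply: f_le; rewrite /= lE leq_add2r.
apply: leq_trans map_le _; rewrite leq_mul2r lE tsize_cat.
by rewrite (leq_trans (size_leq_tsize _) (leq_addl _ _)) orbT.
Qed.

Lemma polytime_flatten G A (l : forall F, env F G -> den F (TList (TList A))) :
  polytime l -> polytime (A := TList A) (fun F e => flatten (l F e)).
Proof.
move=> l_pt.
have flatten_le F (s : den F (TList (TList A))) :
    (tsize (A := TList A) (flatten s) <= tsize (A := TList (TList A)) s)%N.
  elim: s => // x s IHs; rewrite [flatten _]/= tsize_cat.
  exact: (leq_add (leqnSn (tsize (A := TList A) x)) IHs).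
apply: (@polytime_foldr G (TList A) (TList A) l (fun F e => [::])
  (fun F e => e.1 ++ e.2.1)
  (fun F e => tsize (A := TList (TList A)) (l F e)) l_pt)
  => [|||F e l1 l2 lE].
- exact: polytime_nil.
- by apply: polytime_cat; polytime_var.
- exact: polytime_tsize l_pt.
- by rewrite lE tsize_cat; apply: leq_trans (flatten_le F l2) (leq_addl _ _).
Qed.

Lemma polytimeb_has G A (l : forall F, env F G -> den F (TList A))
    (p : forall F, env F (A :: G) -> bool) :
  polytime l -> polytimeb p ->
  polytimeb (fun F e => has (fun x => p F (x, e)) (l F e)).
Proof.
move=> l_pt p_pt.
have foldE F (e : env F G) (s : den F (TList A)) :
    foldr (fun x (y : nat) => if p F (x, e) then 1%N else y) 0%N s =
    has (fun x => p F (x, e)) s.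
  by elim: s => //= x s ->; case: (p F _).
apply: polytime_ext (@polytime_foldr G A TNat l (fun F e => 0%N)
  (fun F e => if p F (e.1, e.2.2) then 1%N else e.2.1) (fun F e => 1%N)
    l_pt _ _ _ _)
  => [F e||||F e l1 l2 _].
- exact: foldE.
- exact: polytime0.
- apply: polytime_if; last by polytime_var.
    exact: (polytime_wk_under TNat p_pt).
  exact/polytimeS/polytime0.
- exact: poly_bounded_const.
- by rewrite [in X in foldr X]/= foldE; case: has.
Qed.

Lemma polytime_find G A (l : forall F, env F G -> den F (TList A))
    (p : forall F, env F (A :: G) -> bool) :
  polytime l -> polytimeb p ->
  polytime (A := TNat) (fun F e => find (fun x => p F (x, e)) (l F e)).
Proof.
move=> l_pt p_pt.
have foldE F (e : env F G) (s : den F (TList A)) :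
    foldr (fun x (y : nat) => if p F (x, e) then 0%N else y.+1) 0%N s =
    find (fun x => p F (x, e)) s.
  by elim: s => //= x s ->.
apply: polytime_ext (@polytime_foldr G A TNat l (fun F e => 0%N)
  (fun F e => if p F (e.1, e.2.2) then 0%N else e.2.1.+1)
  (fun F e => tsize (A := TList A) (l F e)) l_pt _ _ _ _) =>
    [F e||||F e l1 l2 lE].
- exact: foldE.
- exact: polytime0.
- apply: polytime_if;
    [exact: (polytime_wk_under TNat p_pt) | exact: polytime0 |].
  by apply: polytimeS; polytime_var.
- exact: polytime_tsize l_pt.
- rewrite [in X in foldr X]/= foldE lE tsize_cat.
  apply: leq_trans (find_size _ _) _.
  exact: leq_trans (size_leq_tsize _) (leq_addl _ _).
Qed.

Lemma polytime_mkseq G A (m : forall F, env F G -> den F TNat)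
    (f : forall F, env F (TNat :: G) -> den F A) :
    polytime m -> polytime f ->
  polytime (A := TList A) (fun F e => mkseq (fun k => f F (k, e)) (m F e)).
Proof.
move=> m_pt f_pt; have m_size := polytime_tsize m_pt.
have [phi phi_bd f_le] := poly_bounded_env (polytime_tsize f_pt)
  (poly_boundedD m_size (@poly_bounded_esize G)).
have iterE F (e : env F G) j :
    iteri j (fun k (s : den F (TList A)) => rcons s (f F (k, e))) [::] =
    mkseq (fun k => f F (k, e)) j.
  by elim: j => [//|j IHj]; rewrite iteriS IHj mkseqS.
apply: polytime_ext (@polytime_iteri G (TList A) m (fun F e => [::])
  (fun F e => rcons e.2.1 (f F (e.1, e.2.2)))
  (fun F e => m F e * (phi F e).+1)%N m_pt _ _ _ _) => [F e||||F e j le_j].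
- exact: iterE.
- exact: polytime_nil.
- by apply: polytime_rcons;
    [polytime_var | exact: (polytime_wk_under (TList A) f_pt)].
- exact/poly_boundedM/poly_boundedS.
rewrite [in X in iteri _ X]/= iterE.
apply: (@leq_trans (size (iota 0 j) * (phi F e).+1)).
  apply: tsize_map_leq; apply/allP => k; rewrite mem_iota => /andP[_ lt_kj].
  by apply: f_le; rewrite leq_add2r (leq_trans (ltnW lt_kj)).
by rewrite size_iota leq_mul2r le_j orbT.
Qed.

Lemma polytime_iota G (m : forall F, env F G -> den F TNat) :
  polytime m -> polytime (A := TList TNat) (fun F e => iota 0 (m F e)).
Proof.
move=> m_pt.
apply: polytime_ext (polytime_mkseq m_pt (polytime_lookup (VZ G TNat))).
by move=> F e; apply: map_id.
Qed.

Lemma polytime_behead G A (l : forall F, env F G -> den F (TList A)) :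
  polytime l -> polytime (A := TList A) (fun F e => behead (l F e)).
Proof.
move=> l_pt.
apply: polytime_ext (@polytime_listcase G A (TList A) l (fun F e => [::])
  (fun F e => e.2.1) l_pt (polytime_nil G A) _) => [F e|]; last by polytime_var.
by case: (l F e).
Qed.

Lemma polytime_drop G A (k : forall F, env F G -> den F TNat)
    (l : forall F, env F G -> den F (TList A)) :
  polytime k -> polytime l ->
    polytime (A := TList A) (fun F e => drop (k F e) (l F e)).
Proof.
move=> k_pt l_pt; apply: polytime_ext (@polytime_iter G (TList A) k l
  (fun F e => behead e.1) (fun F e => tsize (A := TList A) (l F e)) k_pt
    l_pt _ _ _)
  => [F e|||F e j le_j].
- by rewrite drop_behead.
- by apply: polytime_behead; polytime_var.
- exact: polytime_tsize l_pt.
- rewrite -drop_behead -[X in (_ <= tsize X)%N](cat_take_drop j).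
  by rewrite tsize_cat leq_addl.
Qed.

Lemma polytime_nth G A (x0 : forall F, den F A)
    (l : forall F, env F G -> den F (TList A))
    (k : forall F, env F G -> den F TNat) :
    polytime (fun F (_ : env F G) => x0 F) -> polytime l -> polytime k ->
  polytime (fun F e => nth (x0 F) (l F e) (k F e)).
Proof.
move=> x0_pt l_pt k_pt.
apply: polytime_ext (@polytime_listcase G A A _ (fun F e => x0 F)
  (fun F e => e.1) (polytime_drop k_pt l_pt) x0_pt _) => [F e|];
    last by polytime_var.
rewrite -[in RHS](addn0 (k F e)) -nth_drop nth0; by case: (drop _ _).
Qed.

(** * The hitting-set program *)

Section ListPrograms.

Variable F : fieldType.
Implicit Types (p q c z elts : seq F) (L : seq (seq F)).

Definition mul_seq p q : seq F :=
  mkseq (fun k => \sum_(j < k.+1) p`_j * q`_(k - j)) (size p + size q).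

Definition exp_seq p i : seq F := iter i (mul_seq p) [:: 1].

Definition addC_seq (a : F) p : seq F := (p`_0 + a) :: behead p.

Definition factors_over L p : bool :=
  has (fun h => has (fun h' => Poly h * Poly h' == Poly p) L) L.

Definition find_irreducible L : seq F :=
  rcons (nth [::] L (find (fun c => ~~ factors_over L (rcons c 1)) L)) 1.

Definition extend_lists elts N L : seq (seq F) :=
  if (N <= size L)%N then L else [seq a :: l | a <- elts, l <- L].

Definition enum_lists elts N : seq (seq F) :=
  iter N (extend_lists elts N) [:: [::]].

Definition curve_point n i z : seq (seq F) :=
  z :: mkseq (fun j => exp_seq (addC_seq j.+1%:R z) i) n.-1.

Definition hitting_set n i N elts : seq F * seq (seq (seq F)) :=
  let L := enum_lists elts N in
  (find_irreducible L, [seq curve_point n i z | z <- mkseq (nth [::] L) N]).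

Lemma Poly_mul_seq p q : Poly (mul_seq p q) = Poly p * Poly q.
Proof.
apply/polyP => k; rewrite coef_Poly coefM.
have [lt_k|le_k] := ltnP k (size p + size q).
  by rewrite nth_mkseq //; apply: eq_bigr => j _; rewrite !coef_Poly.
rewrite nth_default ?size_mkseq // big1 // => j _; rewrite !coef_Poly.
have [le_j|lt_j] := leqP (size p) j; first by rewrite nth_default ?mul0r.
rewrite [q`_ _]nth_default ?mulr0 // leq_subRL; last by rewrite -ltnS.
by apply: leq_trans le_k; rewrite leq_add2r ltnW.
Qed.

Lemma Poly_exp_seq p i : Poly (exp_seq p i) = Poly p ^+ i.
Proof.
elim: i => [|i IHi] /=; last by rewrite Poly_mul_seq IHi exprS.
by rewrite cons_poly_def mul0r add0r.
Qed.

Lemma Poly_addC_seq a p : Poly (addC_seq a p) = Poly p + a%:P.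
Proof.
case: p => [|x p]; rewrite /addC_seq /= !cons_poly_def polyCD ?mul0r ?add0r //.
by rewrite addrA.
Qed.

Lemma eq_PolyE p q :
  (Poly p == Poly q) =
    ~~ has (fun k => p`_k != q`_k) (iota 0 (size p + size q)).
Proof.
rewrite -all_predC; apply/eqP/allP => [eq_pq k _ | eq_pq].
  have := congr1 (fun r : {poly F} => r`_k) eq_pq; rewrite !coef_Poly => pq_k.
  by rewrite /= pq_k eqxx.
apply/polyP => k; rewrite !coef_Poly.
have [lt_k|le_k] := ltnP k (size p + size q).
  by apply/eqP; rewrite -[_ == _]negbK; apply: eq_pq; rewrite mem_iota.
by rewrite !nth_default // (leq_trans _ le_k) ?leq_addl ?leq_addr.
Qed.

Lemma size_exp_seq p i : (size (exp_seq p i) <= 1 + size p * i)%N.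
Proof.
elim: i => [|i IHi]; first by rewrite muln0.
by rewrite /= size_mkseq mulnS addnCA leq_add2l.
Qed.

Lemma size_enum_lists elts N k :
  let L := iter k (extend_lists elts N) [:: [::]] in
  (size L <= 1 + size elts * N)%N /\ all (fun l => size l <= k)%N L.
Proof.
elim: k => [//|k] /=; set L := iter k _ _ => -[size_L all_L];
  rewrite /extend_lists.
case: (leqP N (size L)) => [_|lt_LN].
  by split=> //; apply: sub_all all_L => l; apply: leqW.
split; first by rewrite size_allpairs; nia.
by apply/allP => _ /allpairsP [[a l] /= [_ /(allP all_L) le_l ->]].
Qed.

End ListPrograms.

Local Notation TPoly := (TList TFld).

Lemma tsize_poly F (p : den F TPoly) : tsize (A := TPoly) p = size p.
Proof. by elim: p => //= x p ->. Qed.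

Lemma polytime_coef G (p : forall F, env F G -> den F TPoly)
    (k : forall F, env F G -> den F TNat) :
  polytime p -> polytime k ->
    polytime (A := TFld) (fun F e => (p F e)`_(k F e) : F).
Proof. exact: (@polytime_nth G TFld (fun F => 0) p k (polytime_fld0 G)). Qed.

Lemma polytime_mul_seq G (p q : forall F, env F G -> den F TPoly) :
  polytime p -> polytime q ->
  polytime (A := TPoly) (fun F e => mul_seq (p F e) (q F e)).
Proof.
apply: (@polytime_app2 G TPoly TPoly TPoly mul_seq).
apply: (@polytime_mkseq (TPoly :: TPoly :: G) TFld
  (fun F e => size e.1 + size e.2.1)%N
  (fun F e => \sum_(j < e.1.+1) e.2.1`_j * e.2.2.1`_(e.1 - j))).
  by apply: polytimeD; apply: (@polytime_size _ TFld); polytime_var.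
apply: (@polytime_sum (TNat :: TPoly :: TPoly :: G) (fun F e => e.1.+1)
  (fun F e => e.2.2.1`_e.1 * e.2.2.2.1`_(e.2.1 - e.1))).
  by apply: polytimeS; polytime_var.
apply: polytime_fldM; apply: polytime_coef; try polytime_var.
by apply: polytimeB; polytime_var.
Qed.

Lemma polytime_exp_seq G (p : forall F, env F G -> den F TPoly)
    (i : forall F, env F G -> den F TNat) :
  polytime p -> polytime i ->
  polytime (A := TPoly) (fun F e => exp_seq (p F e) (i F e)).
Proof.
move=> p_pt i_pt; apply: (@polytime_iter G TPoly i (fun F e => [:: 1])
  (fun F e => mul_seq (p F e.2) e.1)
  (fun F e => 1 + tsize (A := TPoly) (p F e) * i F e)%N i_pt) =>
    [|||F e k le_k].
- by apply: polytime_cons; [exact: polytime_fld1 | exact: polytime_nil].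
- by apply: polytime_mul_seq; [exact: polytime_wk | polytime_var].
- apply/poly_boundedD/poly_boundedM; first exact: poly_bounded_const.
    exact: polytime_tsize p_pt.
  exact: (polytime_tsize i_pt).
- rewrite !tsize_poly; apply: leq_trans (size_exp_seq (p F e) k) _.
  by rewrite leq_add2l leq_mul2l le_k orbT.
Qed.

Lemma polytime_addC_seq G (a : forall F, env F G -> den F TFld)
    (p : forall F, env F G -> den F TPoly) :
  polytime a -> polytime p ->
  polytime (A := TPoly) (fun F e => addC_seq (a F e : F) (p F e)).
Proof.
move=> a_pt p_pt; apply: polytime_cons; last exact: polytime_behead.
by apply: polytime_fldD a_pt; apply: polytime_coef p_pt (polytime0 G).
Qed.

Lemma polytimeb_eq_Poly G (p q : forall F, env F G -> den F TPoly) :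
  polytime p -> polytime q ->
  polytimeb (fun F e => Poly (p F e : seq F) == Poly (q F e : seq F)).
Proof.
move=> p_pt q_pt.
have has_pt : polytimeb (fun F e => has (fun k => (p F e)`_k != (q F e)`_k :> F)
    (iota 0 (size (p F e) + size (q F e)))).
  apply: (@polytimeb_has G TNat
    (fun F e => iota 0 (size (p F e) + size (q F e)))
    (fun F e => (p F e.2)`_e.1 != (q F e.2)`_e.1 :> F)).
    by apply/polytime_iota/polytimeD; apply: (@polytime_size _ TFld).
  apply/polytimeb_neg/polytimeb_fld_eq; apply: polytime_coef; try polytime_var.
    exact: polytime_wk p_pt.
  exact: polytime_wk q_pt.
by apply: polytime_ext (polytimeb_neg has_pt) => F e; rewrite eq_PolyE.
Qed.

Lemma polytimeb_factors_over G (L : forall F, env F G -> den F (TList TPoly))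
    (p : forall F, env F G -> den F TPoly) :
  polytime L -> polytime p ->
    polytimeb (fun F e => factors_over (L F e) (p F e)).
Proof.
move=> L_pt p_pt.
apply: (@polytimeb_has G TPoly L (fun F e =>
  has (fun h' => Poly (e.1 : seq F) * Poly h' == Poly (p F e.2 : seq F))
    (L F e.2)) L_pt).
apply: (@polytimeb_has (TPoly :: G) TPoly (fun F e => L F e.2) (fun F e =>
  Poly (e.2.1 : seq F) * Poly (e.1 : seq F) == Poly (p F e.2.2 : seq F))).
  exact: polytime_wk L_pt.
have mul_pt : polytimeb (fun F (e : env F (TPoly :: TPoly :: G)) =>
    Poly (mul_seq e.2.1 e.1 : seq F) == Poly (p F e.2.2 : seq F)).
  apply: polytimeb_eq_Poly; last exact: polytime_wk2 p_pt.
  by apply: polytime_mul_seq; polytime_var.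
by apply: polytime_ext mul_pt => F e; rewrite Poly_mul_seq.
Qed.

Lemma polytime_find_irreducible G
    (L : forall F, env F G -> den F (TList TPoly)) :
  polytime L -> polytime (A := TPoly) (fun F e => find_irreducible (L F e)).
Proof.
move=> L_pt; apply: (@polytime_rcons G TFld _ (fun F e => 1));
  last exact: polytime_fld1.
apply: (@polytime_nth G TPoly (fun F => [::])) => //; first exact: polytime_nil.
apply: (@polytime_find G TPoly L (fun F e =>
  ~~ factors_over (L F e.2) (rcons e.1 (1 : F))) L_pt).
apply/polytimeb_neg/polytimeb_factors_over; first exact: polytime_wk L_pt.
by apply: (@polytime_rcons _ TFld); [polytime_var | exact: polytime_fld1].
Qed.

Lemma polytime_extend_lists G (elts : forall F, env F G -> den F TPoly)
    (N : forall F, env F G -> den F TNat)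
    (L : forall F, env F G -> den F (TList TPoly)) :
  polytime elts -> polytime N -> polytime L ->
  polytime (A := TList TPoly)
    (fun F e => extend_lists (elts F e) (N F e) (L F e)).
Proof.
move=> elts_pt N_pt L_pt; apply: (polytime_if _ L_pt).
  exact: (polytimeb_leq N_pt (polytime_size L_pt)).
apply: (@polytime_flatten G TPoly).
apply: (@polytime_map G TFld (TList TPoly) elts
  (fun F e => [seq (e.1 : F) :: l | l <- L F e.2]) elts_pt).
apply: (@polytime_map (TFld :: G) TPoly TPoly (fun F e => L F e.2)
  (fun F e => (e.2.1 : F) :: e.1)); first exact: polytime_wk L_pt.
by apply: polytime_cons; polytime_var.
Qed.

Lemma polytime_enum_lists G (elts : forall F, env F G -> den F TPoly)
    (N : forall F, env F G -> den F TNat) :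
  polytime elts -> polytime N ->
  polytime (A := TList TPoly) (fun F e => enum_lists (elts F e) (N F e)).
Proof.
move=> elts_pt N_pt.
apply: (@polytime_iter G (TList TPoly) N (fun F e => [:: [::]])
  (fun F e => extend_lists (elts F e.2) (N F e.2) e.1)
  (fun F e => (1 + tsize (A := TPoly) (elts F e) * N F e) * (N F e).+1)%N N_pt)
  => [|||F e k le_k].
- by apply: polytime_cons; apply: polytime_nil.
- by apply: polytime_extend_lists;
    [exact: polytime_wk | exact: polytime_wk | polytime_var].
- apply/poly_boundedM/poly_boundedS; last exact: (polytime_tsize N_pt).
  apply/poly_boundedD/poly_boundedM; first exact: poly_bounded_const.
    exact: polytime_tsize elts_pt.
  exact: (polytime_tsize N_pt).
have [size_L all_L] := size_enum_lists (elts F e) (N F e) k.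
rewrite tsize_poly -[X in tsize X](map_id (iter k _ _)).
apply: (@leq_trans
  (size (iter k (extend_lists (elts F e) (N F e)) [:: [::]]) * k.+1)).
  by apply: tsize_map_leq; apply: sub_all all_L => l; rewrite tsize_poly.
exact: leq_mul.
Qed.

Lemma polytime_curve_point G (n i : forall F, env F G -> den F TNat)
    (z : forall F, env F G -> den F TPoly) :
  polytime n -> polytime i -> polytime z ->
  polytime (A := TList TPoly) (fun F e => curve_point (n F e) (i F e) (z F e)).
Proof.
move=> n_pt i_pt z_pt; apply: polytime_cons => //.
apply: (@polytime_mkseq G TPoly (fun F e => (n F e).-1)
  (fun F e => exp_seq (addC_seq (e.1.+1%:R : F) (z F e.2)) (i F e.2))).
  exact: polytime_pred.
apply: polytime_exp_seq; last exact: polytime_wk i_pt.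
apply: polytime_addC_seq; last exact: polytime_wk z_pt.
by apply: polytime_natr; apply: polytimeS; polytime_var.
Qed.

Lemma polytime_hitting_set G (n i N : forall F, env F G -> den F TNat)
    (elts : forall F, env F G -> den F TPoly) :
  polytime n -> polytime i -> polytime N -> polytime elts ->
  polytime (A := TProd TPoly (TList (TList TPoly)))
    (fun F e => hitting_set (n F e) (i F e) (N F e) (elts F e)).
Proof.
move=> n_pt i_pt N_pt elts_pt.
pose points F (e : env F (TList TPoly :: G)) :
    den F (TProd TPoly (TList (TList TPoly))) :=
  (find_irreducible e.1, [seq curve_point (n F e.2) (i F e.2) z |
     z <- mkseq (nth [::] (e.1 : seq (seq F))) (N F e.2)]).
suff points_pt : polytime points.
  exact: (polytime_let (polytime_enum_lists elts_pt N_pt) points_pt).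
apply: polytime_pair; first by apply: polytime_find_irreducible; polytime_var.
apply: (@polytime_map (TList TPoly :: G) TPoly (TList TPoly)
  (fun F e => mkseq (nth [::] (e.1 : seq (seq F))) (N F e.2))
  (fun F e => curve_point (n F e.2.2) (i F e.2.2) e.1)).
  apply: (@polytime_mkseq (TList TPoly :: G) TPoly (fun F e => N F e.2)
    (fun F e => nth [::] e.2.1 e.1)); first exact: polytime_wk N_pt.
  apply: (@polytime_nth _ TPoly (fun F => [::])); try polytime_var.
  exact: polytime_nil.
apply: polytime_curve_point;
  [exact: polytime_wk2 n_pt | exact: polytime_wk2 i_pt |].
by polytime_var.
Qed.

(* Its cost does not depend on the length of the list: the input list of field
   elements may be much longer than the running time allowed. *)
Definition rev_take_term G (tN : tm G TNat) (tl : tm G TPoly) : tm G TPoly :=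
  let state := TProd TPoly TPoly in
  let acc := Snd (Var (VS TFld (VS TPoly (VS TNat (VZ G state))))) in
  Snd (NatRec tN (Pair tl (Nil _ _))
    (ListCase (Fst (Var (VS TNat (VZ G state)))) (Var (VS TNat (VZ G state)))
      (Pair (Var (VS TFld (VZ _ TPoly))) (Cons (Var (VZ _ TFld)) acc)))).

Lemma eval_rev_take_term F G (tN : tm G TNat) tl (e : env F G) :
  eval (rev_take_term tN tl) e = rev (take (eval tN e) (eval tl e : seq F)).
Proof.
rewrite /=; set l := (eval tl e : seq F); set f := (fun _ _ => _).
suff iterE j : iteri j f (l, [::]) = (drop j l, rev (take j l)).
  by rewrite iterE.
elim: j => [|j /= ->]; first by rewrite drop0 take0.
have [lt_j|le_j] := ltnP j (size l).
  by rewrite /f /= (drop_nth 0 lt_j) /= (take_nth 0 lt_j) rev_rcons.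
by rewrite /f /= drop_oversize // drop_oversize ?leqW // !take_oversize ?leqW.
Qed.

Lemma cost_rev_take_term F G (tN : tm G TNat) tl (e : env F G) :
  (cost (rev_take_term tN tl) e <= cost tN e + cost tl e + eval tN e * 9 + 4)%N.
Proof.
rewrite [cost _ _]/=; set S := (\sum_(_ < _) _)%N.
suff : (S <= eval tN e * 9)%N by move: (cost _ _) (cost _ _) => a b; lia.
rewrite /S -[X in (_ <= X * _)%N]card_ord -sum_nat_const; apply: leq_sum => k _.
by case: (iteri _ _ _).1.
Qed.

Fixpoint append_var H G A (v : var G A) : var (G ++ H) A :=
  match v in var G A return var (G ++ H) A with
  | VZ _ _ => VZ _ _
  | VS _ _ _ v => VS _ (append_var H v)
  end.

Fixpoint env_prefix F H G : env F (G ++ H) -> env F G :=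
  match G return env F (G ++ H) -> env F G with
  | [::] => fun _ => tt
  | A :: G => fun e => (e.1, env_prefix e.2)
  end.

Lemma renames_append F H G (e : env F (G ++ H)) :
  renames (@append_var H G) e (env_prefix e).
Proof. by move=> A v; elim: v e => //= *. Qed.

Definition num_points (n r s d delta k : nat) : nat :=
  (d * delta * curve_degree r s n * k.+1)%N.

(* The predecessor of the accuracy, as bound by [NatCase], followed by all the
   inputs but the list of field elements. *)
Definition nat_ctx : seq ty := nseq 7 TNat.

Definition points_ctx : seq ty := [:: TPoly, TNat & nat_ctx].

Definition hs_type : ty := TProd TPoly (TList (TList TPoly)).

Section Program.

Variables (tN : tm nat_ctx TNat) (tH : tm points_ctx hs_type).

Let elts_ctx : seq ty := [:: TPoly].

Let elts_var : var (TNat :: nat_ctx ++ elts_ctx) TPoly :=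
  VS _ (VS _ (VS _ (VS _ (VS _ (VS _ (VS _ (VS _ (VZ [::] TPoly)))))))).

Let accuracy_var : var (behead nat_ctx ++ elts_ctx) TNat :=
  VS _ (VS _ (VS _ (VS _ (VS _ (VZ elts_ctx TNat))))).

Let list_term : tm (TNat :: nat_ctx ++ elts_ctx) TPoly :=
  rev_take_term (Var (VZ _ _)) (Var elts_var).

Definition program_of_terms : hs_program :=
  NatCase (Var accuracy_var)
    (Pair (Cons (FZero _) (Cons (FOne _) (Nil _ _))) (Nil _ _))
    (Let (rename tN (@append_var elts_ctx nat_ctx))
      (Let list_term (rename tH (@append_var elts_ctx points_ctx)))).

Variable F : fieldType.
Variables (n r s d delta : nat) (elts : seq F).

Definition nat_env (k : nat) : env F nat_ctx :=
  (k, (n, (r, (s, (d, (delta, (k.+1, tt))))))).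

Definition points_env (k N : nat) : env F points_ctx :=
  (rev (take N elts), (N, nat_env k)).

Lemma eval_program0 :
  eval program_of_terms (hs_input n r s d delta 0 elts) = ([:: 0; 1], [::]).
Proof. by []. Qed.

Lemma cost_program0 :
  (cost program_of_terms (hs_input n r s d delta 0 elts) <= 9)%N.
Proof. by []. Qed.

Variable k : nat.
Let N : nat := eval tN (nat_env k).
Let inner_env : env F (nat_ctx ++ elts_ctx) :=
  (k, hs_input n r s d delta k.+1 elts).
Let list_env : env F (TNat :: nat_ctx ++ elts_ctx) := (N, inner_env).
Let full_env : env F (points_ctx ++ elts_ctx) := (rev (take N elts), list_env).

Let eval_tN : eval (rename tN (@append_var elts_ctx nat_ctx)) inner_env = N.
Proof. exact: (eval_rename tN (renames_append inner_env)). Qed.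

Let eval_list : eval list_term list_env = rev (take N elts).
Proof. exact: eval_rev_take_term. Qed.

Lemma eval_programS :
  eval program_of_terms (hs_input n r s d delta k.+1 elts) =
    eval tH (points_env k N).
Proof.
transitivity (eval (rename tH (@append_var elts_ctx points_ctx)) full_env).
  by rewrite /full_env -eval_list /list_env -eval_tN.
exact: (eval_rename tH (renames_append full_env)).
Qed.

Lemma cost_programS :
  (cost program_of_terms (hs_input n r s d delta k.+1 elts) <=
   cost tN (nat_env k) + cost tH (points_env k N) + 9 * N + 10)%N.
Proof.
have costE : cost program_of_terms (hs_input n r s d delta k.+1 elts) =
    (cost (rename tN (@append_var elts_ctx nat_ctx)) inner_env +
     (cost list_term list_env +
      cost (rename tH (@append_var elts_ctx points_ctx)) full_env).+1).+3%N.
  by rewrite /full_env -eval_list /list_env -eval_tN.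
rewrite costE (cost_rename tN (renames_append inner_env)).
rewrite (cost_rename tH (renames_append full_env)).
have list_le : (cost list_term list_env <= N * 9 + 6)%N.
  by apply: leq_trans (cost_rev_take_term _ _ _) _;
    rewrite /= addnC addnA addnC.
have -> : env_prefix inner_env = nat_env k by [].
have -> : env_prefix full_env = points_env k N by [].
by move: list_le; move: (cost _ _) (cost _ _) (cost _ _) => *; lia.
Qed.

End Program.

Lemma polytime_curve_degree G (r s n : forall F, env F G -> den F TNat) :
  polytime r -> polytime s -> polytime n ->
  polytime (A := TNat) (fun F e => curve_degree (r F e) (s F e) (n F e)).
Proof. by move=> r_pt s_pt n_pt; do !apply: polytimeM. Qed.

Lemma polytime_num_points : polytime (G := nat_ctx) (A := TNat) (fun F e =>
  num_points e.2.1 e.2.2.1 e.2.2.2.1 e.2.2.2.2.1 e.2.2.2.2.2.1 e.1.+1).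
Proof.
apply: polytimeM; last by do 2!apply: polytimeS; polytime_var.
apply: polytimeM; first by apply: polytimeM; polytime_var.
by apply: polytime_curve_degree; polytime_var.
Qed.

Lemma polytime_hitting_set_input :
  polytime (G := points_ctx) (A := hs_type) (fun F e =>
    hitting_set e.2.2.2.1 (curve_degree e.2.2.2.2.1 e.2.2.2.2.2.1 e.2.2.2.1)
      e.2.1 e.1).
Proof.
by apply: polytime_hitting_set; try polytime_var;
  apply: polytime_curve_degree; polytime_var.
Qed.

Lemma ltn_num_points n r s d delta k :
    (0 < n)%N -> (0 < r)%N -> (0 < s)%N -> (0 < d)%N -> (0 < delta)%N ->
  (k < num_points n r s d delta k)%N.
Proof.
move=> n_gt0 r_gt0 s_gt0 d_gt0 delta_gt0; apply: leq_pmull.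
by rewrite !muln_gt0 n_gt0 r_gt0 s_gt0 d_gt0 delta_gt0.
Qed.

Lemma esize_nat_env F n r s d delta k :
    (0 < n)%N -> (0 < r)%N -> (0 < s)%N -> (0 < d)%N -> (0 < delta)%N ->
  (esize (nat_env F n r s d delta k) <= 7 * num_points n r s d delta k.+1)%N.
Proof.
move=> n_gt0 r_gt0 s_gt0 d_gt0 delta_gt0; set N := num_points _ _ _ _ _ _.
have lt_kN : (k.+1 < N)%N by apply: ltn_num_points.
have leN x : (x %| N -> x <= N)%N by apply/dvdn_leq/(leq_ltn_trans _ lt_kN).
have NE : N = (d * delta * (r * (s * s) * n) * k.+2)%N.
  by rewrite /N /num_points /curve_degree -mulnn.
have le_n : (n <= N)%N.
  by apply: leN; rewrite NE dvdn_mulr // dvdn_mull // dvdn_mull.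
have le_r : (r <= N)%N.
  by apply: leN; rewrite NE dvdn_mulr // dvdn_mull // !dvdn_mulr.
have le_s : (s <= N)%N.
  apply: leN; rewrite NE dvdn_mulr // dvdn_mull //.
  by rewrite dvdn_mulr // dvdn_mull // dvdn_mulr.
have le_d : (d <= N)%N by apply: leN; rewrite NE !dvdn_mulr.
have le_delta : (delta <= N)%N.
  by apply: leN; rewrite NE dvdn_mulr // dvdn_mulr // dvdn_mull.
by rewrite /nat_env /=; lia.
Qed.

Lemma exp_add2_leq N x c :
  (0 < N)%N -> (x <= 9 * N)%N -> (x.+2 ^ c <= N.+1 ^ (4 * c))%N.
Proof.
move=> N_gt0 le_x; rewrite expnM; case: c => // c; rewrite leq_exp2r //.
apply: (@leq_trans (9 * N).+2); first by rewrite !ltnS.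
by rewrite (expnM _ 2 2) -!mulnn; nia.
Qed.

Lemma hs_program_exists : exists (P : hs_program) (C : nat), (2 <= C)%N /\
  forall (F : fieldType) n r s d delta (elts : seq F),
    [/\ eval P (hs_input n r s d delta 0 elts) = ([:: 0; 1], [::]),
        (cost P (hs_input n r s d delta 0 elts) <= C)%N &
        forall k,
          (0 < n)%N -> (0 < r)%N -> (0 < s)%N -> (0 < d)%N -> (0 < delta)%N ->
        let N := num_points n r s d delta k.+1 in
        eval P (hs_input n r s d delta k.+1 elts) =
          hitting_set n (curve_degree r s n) N (rev (take N elts)) /\
        (cost P (hs_input n r s d delta k.+1 elts) <= C * N.+1 ^ C)%N].
Proof.
have [tN [tNE [a tN_cost] _]] := polytime_num_points.
have [tH [tHE [b tH_cost] _]] := polytime_hitting_set_input.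
exists (program_of_terms tN tH), (4 * a + 4 * b + 21)%N; split; first by lia.
move=> F n r s d delta elts; split=> [||k n_gt0 r_gt0 s_gt0 d_gt0 delta_gt0 N].
- exact: eval_program0.
- by apply: leq_trans (cost_program0 tN tH n r s d delta elts) _; lia.
have tN_eval : eval tN (nat_env F n r s d delta k) = N by rewrite tNE.
split; first by rewrite eval_programS tN_eval tHE.
have N_gt0 : (0 < N)%N by apply: leq_ltn_trans (ltn_num_points _ _ _ _ _ _).
have nat_env_le : (esize (nat_env F n r s d delta k) <= 7 * N)%N.
  exact: esize_nat_env.
have points_env_le : (esize (points_env n r s d delta elts k N) <= 9 * N)%N.
  have list_le : (tsize (A := TPoly) (rev (take N elts)) <= N)%N.
    by rewrite tsize_poly size_rev size_take_min geq_minl.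
  by apply: leq_trans (leq_add list_le (leq_add (leqnn N) nat_env_le)) _; lia.
have tN_le : (cost tN (nat_env F n r s d delta k) <= N.+1 ^ (4 * a))%N.
  by apply: leq_trans (tN_cost _ _) (exp_add2_leq a N_gt0 _); lia.
have tH_le : (cost tH (points_env n r s d delta elts k N) <= N.+1 ^ (4 * b))%N.
  exact: leq_trans (tH_cost _ _) (exp_add2_leq b N_gt0 _).
apply: leq_trans (cost_programS tN tH n r s d delta elts k) _; rewrite tN_eval.
set C := (4 * a + 4 * b + 21)%N.
have exp_le c : (c <= C)%N -> (N.+1 ^ c <= N.+1 ^ C)%N by apply: leq_pexp2l.
have {}tN_le := leq_trans tN_le (exp_le (4 * a)%N ltac:(lia)).
have {}tH_le := leq_trans tH_le (exp_le (4 * b)%N ltac:(lia)).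
have base_le := exp_le 1%N ltac:(lia); rewrite expn1 in base_le.
apply: (@leq_trans (21 * N.+1 ^ C)); last by rewrite leq_mul2r /C leq_addl orbT.
by move: tN_le tH_le base_le; move: (cost _ _) (cost _ _) (_ ^ C)%N => *; lia.
Qed.

(** * Irreducible polynomials over finite fields *)

Lemma prim_root_exists_ext (F : finFieldType) N :
    N%:R != 0 :> F ->
  exists (L : splittingFieldType F) (z : L), N.-primitive_root z.
Proof.
move=> N_neq0; have N_gt0 : (0 < N)%N by case: N N_neq0; rewrite ?eqxx.
pose q : {poly F} := 'X^N - 1.
have q_neq0 : q != 0 by rewrite -size_poly_gt0 size_XnsubC.
have [L [rs]] := FinSplittingFieldFor q_neq0.
rewrite rmorphB rmorph1 /= map_polyXn => q_rs _.
have rs_uniq : uniq rs.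
  rewrite -separable_prod_XsubC -(eqp_separable q_rs) separable_Xn_sub_1 //.
  by rewrite -(rmorph_nat (in_alg L)) fmorph_eq0.
have rs_size : size rs = N.
  by apply: succn_inj;
    rewrite -(size_prod_XsubC _ id) -(eqp_size q_rs) size_XnsubC.
have rs_unity : all N.-unity_root rs.
  by apply/allP => z; rewrite -root_prod_XsubC -(eqp_root q_rs).
have /hasP[z _ z_prim] :=
  has_prim_root N_gt0 rs_unity rs_uniq (eq_leq (esym rs_size)).
by exists L, z.
Qed.

Section FiniteSplittingField.

Variables (F : finFieldType) (L : splittingFieldType F).

Lemma dim_leq_expf_card (E : {vspace L}) k :
    (0 < k)%N -> {in E, forall x, x ^+ (#|F| ^ k) = x} ->
  (\dim E <= k)%N.
Proof.
move=> k_gt0 E_roots; have F_gt1 := finNzRing_gt1 F.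
set m := (#|F| ^ k)%N in E_roots.
have m_gt1 : (1 < m)%N by rewrite (ltn_exp2l 0).
rewrite -(leq_exp2l _ _ F_gt1) -/m -(card_vspace (E : {vspace finvect_type L})).
pose q : {poly L} := 'X^m - 'X.
pose rs : seq L := enum (E : {vspace finvect_type L}).
have q_size : size q = m.+1.
  by rewrite size_polyDl size_polyXn // size_polyN size_polyX ltnS.
have q_neq0 : q != 0 by rewrite -size_poly_gt0 q_size.
have rs_roots : all (root q) rs.
  apply/allP => x;
    rewrite [_ \in _](mem_enum (E : {vspace finvect_type L})) => xE.
  by rewrite rootE !hornerE E_roots ?subrr.
have := max_poly_roots q_neq0 rs_roots (enum_uniq _).
by rewrite q_size ltnS cardE.
Qed.

Lemma adjoin_fixes_exp_card (z : L) k :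
  z ^+ (#|F| ^ k) = z -> {in <<1; z>>%VS, forall x, x ^+ (#|F| ^ k) = x}.
Proof.
have [/= a _ aE] := finField_galois_generator (sub1v {:L}).
have {aE} aX x m : (a ^+ m)%g x = x ^+ (#|F| ^ m).
  elim: m => [|m IHm]; first by rewrite gal_id expr1.
  by rewrite expgSr expnSr exprM -IHm galM ?memvf // aE ?memvf // dimv1 expn1.
move=> z_fixed x x_z; rewrite -aX; apply/fixedSpaceP; apply: subvP x_z.
have z_fix : z \in fixedSpace (a ^+ k)%g by apply/fixedSpaceP; rewrite aX.
by apply/FadjoinP; rewrite sub1v.
Qed.

Lemma adjoin_degree_prim_root (z : L) k :
    (0 < k)%N -> (#|F| ^ k - 1).-primitive_root z -> adjoin_degree 1 z = k.
Proof.
move=> k_gt0 z_prim; have F_gt1 := finNzRing_gt1 F.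
have degreeE : adjoin_degree 1 z = \dim <<1; z>>.
  by rewrite dim_Fadjoin dimv1 muln1.
have expK m : (0 < #|F| ^ m)%N by rewrite expn_gt0 ltnW.
apply/eqP; rewrite degreeE eqn_leq; apply/andP; split.
  apply: (dim_leq_expf_card k_gt0); apply: adjoin_fixes_exp_card.
  by rewrite -(subnK (expK k)) exprD (prim_expr_order z_prim) mul1r.
have z_fixed : z ^+ (#|F| ^ \dim <<1; z>>) = z.
  by apply/eqP; rewrite -Fermat's_little_theorem memv_adjoin.
have : (#|F| ^ k - 1 %| #|F| ^ \dim <<1; z>> - 1)%N.
  by rewrite -eqn_mod_dvd // -(eq_prim_root_expr z_prim) z_fixed.
have dim_gt0 : (0 < \dim <<1; z>>)%N by apply: adim_gt0.
move/dvdn_leq; rewrite subn_gt0 (ltn_exp2l 0) // leq_sub2rE // leq_exp2l //.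
exact.
Qed.

End FiniteSplittingField.

Lemma irreducible_poly_exists (F : finFieldType) k : (0 < k)%N ->
  exists2 g : {poly F}, g \is monic & size g = k.+1 /\ irreducible_poly g.
Proof.
move=> k_gt0; have F_gt1 := finNzRing_gt1 F.
have expK : (0 < #|F| ^ k)%N by rewrite expn_gt0 ltnW.
have card_F0 : #|F|%:R = 0 :> F.
  by rewrite -FinRing.zmodXgE -cardsT expg_cardG ?inE.
have [|L [z z_prim]] := @prim_root_exists_ext F (#|F| ^ k - 1).
  by rewrite natrB // natrX card_F0 expr0n gtn_eqF // sub0r oppr_eq0 oner_eq0.
have [g gE] := polyOver1P (minPolyOver 1 z).
have g_size : size g = k.+1.
  by rewrite -(size_map_poly (in_alg L)) -gE size_minPoly
    (adjoin_degree_prim_root k_gt0).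
exists g; first by rewrite -(map_monic (in_alg L)) -gE monic_minPoly.
split=> //; split=> [|h h_size h_g]; first by rewrite g_size.
have := @minPoly_irr _ _ 1%AS z (map_poly (in_alg L) h) _ _.
rewrite gE dvdp_map eqp_map h_g -size_poly_eq1 size_map_poly (negPf h_size)
  orbF.
by apply=> //; apply/polyOver1P; exists h.
Qed.

Lemma irreducible_poly_exists_enum (F : fieldType) (elts : seq F) k :
    uniq elts -> (forall x, x \in elts) -> (0 < k)%N ->
  exists2 g : {poly F}, g \is monic & size g = k.+1 /\ irreducible_poly g.
Proof.
move=> elts_uniq elts_all.
have eltsK : pcancel (fun x => index x elts) (fun j => Some (nth 0 elts j)).
  by move=> x; rewrite nth_index.
have elts_enum : Finite.axiom elts.
  by move=> x; rewrite count_uniq_mem // elts_all.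
pose FF : finFieldType :=
  HB.pack F (isCountable.Build F eltsK) (isFinite.Build F elts_enum).
exact: (@irreducible_poly_exists FF k).
Qed.

(** * Correctness of the program *)

Section ListEnumeration.

Variables (F : fieldType) (elts : seq F).
Hypothesis elts_uniq : uniq elts.

Definition lists_of_length m (L : seq (seq F)) : Prop :=
  [/\ uniq L, size L = (size elts ^ m)%N &
      L =i [pred l | (size l == m) && all (mem elts) l]].

Lemma lists_of_length_cons m L :
  lists_of_length m L -> lists_of_length m.+1 [seq a :: l | a <- elts, l <- L].
Proof.
move=> [L_uniq L_size L_mem]; split.
- by apply: allpairs_uniq => // -[a l] [a' l'] _ _ /= [-> ->].
- by rewrite size_allpairs L_size expnS.
move=> [|a l]; first by apply/negbTE/allpairsP => -[[? ?] [_ _]].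
have -> : (a :: l \in [seq a :: l | a <- elts, l <- L]) =
    (a \in elts) && (l \in L).
  apply/allpairsP/andP => [[[a' l'] /= [a'_elts l'_L [-> ->]]] //|[a_elts l_L]].
  by exists (a, l).
by rewrite L_mem !inE /= eqSS andbCA.
Qed.

(* The second alternative records that the lengths grow only while there are
   too few lists. *)
Lemma iter_extend_lists N k :
  exists m, [/\ lists_of_length m (iter k (extend_lists elts N) [:: [::]]),
    m = k \/ (N <= size elts ^ m)%N & m = 0%N \/ (size elts ^ m.-1 < N)%N].
Proof.
elim: k => [|k [m [L_lists m_stop m_min]]].
  by exists 0%N; split; [split=> // l; rewrite inE; case: l | left | left].
rewrite /=; set L := iter k _ _ in L_lists *.
rewrite /extend_lists; have [_ -> _] := L_lists.
have [leNm|ltmN] := leqP N (size elts ^ m).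
  by exists m; split=> //; right.
have {m_stop} -> : k = m by case: m_stop => [->//|]; rewrite leqNgt ltmN.
by exists m.+1; split; [exact: lists_of_length_cons | left | right].
Qed.

Lemma enum_listsP N : (1 < size elts)%N -> (1 < N)%N ->
  exists m, [/\ (0 < m)%N, lists_of_length m (enum_lists elts N),
    (N <= size (enum_lists elts N))%N & (N <= size elts)%N -> m = 1%N].
Proof.
move=> elts_gt1 N_gt1; have [m [L_lists m_stop m_min]] := iter_extend_lists N N.
have leN : (N <= size elts ^ m)%N.
  by case: m_stop => // ->; apply/ltnW/ltn_expl.
have m_gt0 : (0 < m)%N by case: (m) leN => //; rewrite expn0; lia.
exists m; split=> // [|le_elts]; first by have [_ -> _] := L_lists.
case: m_min => [|lt_N]; first by lia.
have : (size elts ^ m.-1 < size elts ^ 1)%N by rewrite expn1 (leq_trans lt_N).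
by rewrite ltn_exp2l // => lt_m1; lia.
Qed.

End ListEnumeration.

Section MonicLists.

Variables (F : fieldType) (elts : seq F).

Lemma size_Poly_rcons1 (c : seq F) : size (Poly (rcons c 1)) = (size c).+1.
Proof. by rewrite (PolyK (c := 0)) ?last_rcons ?oner_eq0 ?size_rcons. Qed.

Lemma Poly_mkseq (p : {poly F}) m :
  (size p <= m)%N -> Poly (mkseq (fun j => p`_j) m) = p.
Proof.
move=> le_pm; apply/polyP => j; rewrite coef_Poly.
have [lt_jm|le_mj] := ltnP j m; first by rewrite nth_mkseq.
by rewrite !nth_default ?size_mkseq // (leq_trans le_pm).
Qed.

Variables (m : nat) (L : seq (seq F)).
Hypothesis m_gt0 : (0 < m)%N.
Hypothesis L_lists : lists_of_length elts m L.

Lemma size_Poly_lists l : l \in L -> (size (Poly l) <= m)%N.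
Proof.
by have [_ _ ->] := L_lists; case/andP => /eqP <- _; apply: size_Poly.
Qed.

Lemma irreducible_not_factors c :
  c \in L -> irreducible_poly (Poly (rcons c 1)) ->
    ~~ factors_over L (rcons c 1).
Proof.
move=> c_L [_ c_irr]; apply/hasPn => h h_L; apply/hasPn => h' h'_L.
have c_size : size (Poly (rcons c 1)) = m.+1.
  rewrite size_Poly_rcons1; have [_ _ mem_L] := L_lists.
  by move: c_L; rewrite mem_L => /andP[/eqP->].
apply/eqP => hh'.
have c_neq0 : Poly (rcons c 1) != 0 by rewrite -size_poly_gt0 c_size.
have /norP[h_neq0 h'_neq0] : ~~ ((Poly h == 0) || (Poly h' == 0)).
  by rewrite -mulf_eq0 hh'.
have [h_const|h_nconst] := eqVneq (size (Poly h)) 1%N.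
  have := size_mul h_neq0 h'_neq0.
  rewrite hh' c_size h_const add1n /= => h'_size.
  by have := size_Poly_lists h'_L; rewrite -h'_size ltnn.
have /eqp_size : Poly h %= Poly (rcons c 1).
  by apply: c_irr; rewrite // -hh' dvdp_mulr.
by have := size_Poly_lists h_L; rewrite c_size => /[swap] ->; rewrite ltnn.
Qed.

Hypothesis L_complete : m = 1%N \/ forall x, x \in elts.

Lemma not_factors_irreducible c :
  c \in L -> ~~ factors_over L (rcons c 1) ->
    irreducible_poly (Poly (rcons c 1)).
Proof.
have [_ _ mem_L] := L_lists.
move=> c_L no_factor.
have /andP[/eqP c_size _] : (size c == m) && all (mem elts) c.
  by have := c_L; rewrite mem_L.
have g_size := size_Poly_rcons1 c; rewrite c_size in g_size.
set g := Poly _ in g_size *.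
have g_neq0 : g != 0 by rewrite -size_poly_gt0 g_size.
split=> [|q q_nconst q_g]; first by rewrite g_size.
rewrite -dvdp_size_eqp // g_size eqn_leq -{1}g_size dvdp_leq //=.
apply: contraNT no_factor; rewrite -ltnNge ltnS => q_small.
have [u gE] := dvdpP _ _ q_g.
have /norP[u_neq0 q_neq0] : ~~ ((u == 0) || (q == 0)) by rewrite -mulf_eq0 -gE.
have q_gt1 : (1 < size q)%N by rewrite ltn_neqAle eq_sym q_nconst size_poly_gt0.
case: L_complete => [m1|elts_all].
  by have := leq_trans q_gt1 q_small; rewrite m1.
have u_small : (size u <= m)%N.
  have := size_mul u_neq0 q_neq0; rewrite -gE g_size.
  by move: (size q) (size u) q_gt1 => a b; lia.
have mkseq_L (p : {poly F}) : mkseq (fun j => p`_j) m \in L.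
  by rewrite mem_L inE size_mkseq eqxx; apply/allP => x _; apply: elts_all.
apply/hasP; exists (mkseq (fun j => u`_j) m); first exact: mkseq_L.
apply/hasP; exists (mkseq (fun j => q`_j) m); first exact: mkseq_L.
by rewrite !Poly_mkseq // -gE.
Qed.

Hypothesis elts_uniq : uniq elts.
Hypothesis L_gt0 : (0 < size L)%N.

Lemma irreducible_in_lists :
  exists2 c, c \in L & irreducible_poly (Poly (rcons c 1)).
Proof.
have [_ _ mem_L] := L_lists.
case: L_complete => [m1|elts_all].
  have [c c_L] : exists c, c \in L.
    by case: L L_gt0 => // c L' _; exists c; apply: mem_head.
  exists c => //; move: c_L; rewrite mem_L m1 => /andP[/eqP].
  case: c => [//|x [|//]] _ _ /=.
  by rewrite !cons_poly_def mul0r add0r mul1r; apply: irredp_XaddC.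
have [g g_monic [g_size g_irr]] :=
  irreducible_poly_exists_enum elts_uniq elts_all m_gt0.
exists (mkseq (fun j => g`_j) m).
  by rewrite mem_L inE size_mkseq eqxx; apply/allP => x _; apply: elts_all.
suff -> : Poly (rcons (mkseq (fun j => g`_j) m) 1) = g by [].
apply/polyP => j; rewrite coef_Poly nth_rcons size_mkseq.
case: ltngtP => [lt_j|gt_j|->]; first by rewrite nth_mkseq.
  by rewrite nth_default // g_size.
by have := monicP g_monic; rewrite lead_coefE g_size.
Qed.

Lemma find_irreducibleP :
  irreducible_poly (Poly (find_irreducible L)) /\
    size (Poly (find_irreducible L)) = m.+1.
Proof.
have [c0 c0_L c0_irr] := irreducible_in_lists.
pose P c := ~~ factors_over L (rcons c 1).
have has_P : has P L.
  by apply/hasP; exists c0 => //; apply: irreducible_not_factors.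
rewrite /find_irreducible; set c := nth _ _ _.
have c_L : c \in L by rewrite mem_nth // -has_find.
split; first by apply: not_factors_irreducible => //; apply: (nth_find _ has_P).
rewrite size_Poly_rcons1; have [_ _ mem_L] := L_lists.
by move: c_L; rewrite mem_L => /andP[/eqP->].
Qed.

End MonicLists.

Lemma root_presents_exists (F : fieldType) (g : {poly F}) :
  irreducible_poly g ->
  exists (E : fieldExtType F) (theta : E), root_presents g theta /\
    (size g = 2 -> {:E}%VS = 1%VS).
Proof.
move=> g_irr.
have [E E_dim [theta theta_root theta_gen]] := irredp_FAdjoin g_irr.
exists E, theta; split=> // g_size; apply/eqP; rewrite eq_sym eqEdim sub1v.
by rewrite E_dim g_size dimv1.
Qed.

Section CurvePoints.

Variables (F : fieldType) (E : fieldExtType F) (theta : E) (n' i : nat).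
Let n := n'.+1.

Definition curve_shift (a : 'I_n) : F := - (nat_of_ord a)%:R.

Definition parameter (z : seq F) : E := (map_poly (in_alg E) (Poly z)).[theta].

Lemma curve_shift_inj T : pchar_gt F T -> (n <= T)%N -> injective curve_shift.
Proof.
move=> charF le_nT a a' /oppr_inj eq_aa'; apply: val_inj.
have [lt_a lt_a'] := (ltn_ord a, ltn_ord a').
by apply: (natr_inj_near charF) eq_aa'; lia.
Qed.

Lemma parameter_inj (g : {poly F}) m :
    root_presents g theta -> size g = m.+1 ->
  {in [pred z | size z == m] &, injective parameter}.
Proof.
move=> [g_irr theta_root _] g_size z z' /eqP z_size /eqP z'_size eq_zz'.
pose p := Poly z - Poly z'.
have p_size : (size p < size g)%N.
  rewrite g_size ltnS; apply: leq_trans (size_polyD _ _) _.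
  rewrite size_polyN geq_max.
  by rewrite -{1}z_size -{1}z'_size !size_Poly.
have p_root : (map_poly (in_alg E) p).[theta] = 0.
  by rewrite rmorphB hornerD hornerN -/(parameter z) -/(parameter z') eq_zz'
    subrr.
have /eqP : p = 0.
  apply: contra_eq p_root => p_neq0.
  have : coprimep g p.
    rewrite irreducible_poly_coprime //; apply/negP => /(dvdp_leq p_neq0).
    by rewrite leqNgt p_size.
  by rewrite -(coprimep_map (in_alg E)) => /coprimep_root /(_ theta_root).
rewrite subr_eq0 => /eqP eq_Poly; apply: (@eq_from_nth _ 0) => [|j _].
  by rewrite z_size.
by have := congr1 (fun q : {poly F} => q`_j) eq_Poly; rewrite !coef_Poly.
Qed.

Lemma decode_curve_point z (a : 'I_n) :
  decode_point theta n (curve_point n i z) a =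
  (map_poly (in_alg E) (curve i curve_shift a)).[parameter z].
Proof.
rewrite ffunE /curve /curve_weight rmorphXn rmorphB /= map_polyX map_polyC /=.
rewrite !hornerE /curve_shift /= scaleNr opprK.
case: a => -[|a] lt_a; first by rewrite scale0r addr0 expr1.
by rewrite /= nth_mkseq // Poly_exp_seq Poly_addC_seq rmorphXn rmorphD /=
  map_polyC !hornerE.
Qed.

Lemma meval_curve_point (f : {mpoly F[n]}) z :
  (map_mpoly (in_alg E) f).@[decode_point theta n (curve_point n i z)] =
  (map_poly (in_alg E) (restrict i curve_shift f)).[parameter z].
Proof.
rewrite mevalE (perm_big _ (msupp_map_mpoly f (fmorph_inj (in_alg E)))) /=.
rewrite /restrict /mmap rmorph_sum horner_sum; apply: eq_bigr => m _.
rewrite mcoeff_map_mpoly rmorphM /= map_polyC hornerM hornerC; congr (_ * _).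
rewrite /mmap1 rmorph_prod horner_prod; apply: eq_bigr => a _.
by rewrite decode_curve_point [in RHS]rmorphXn /= horner_exp.
Qed.

Lemma uniq_curve_points (Z : seq (seq F)) :
  uniq [seq parameter z | z <- Z] ->
  uniq [seq decode_point theta n (curve_point n i z) | z <- Z].
Proof.
pose first_coord (v : {ffun 'I_n -> E}) := v ord0; move=> Z_uniq.
apply: (@map_uniq _ _ first_coord); rewrite -map_comp.
by rewrite (_ : map _ Z = map parameter Z) //; apply: eq_map => z;
  rewrite /= /first_coord ffunE.
Qed.

Lemma count_curve_points (f : {mpoly F[n]}) (Z : seq (seq F)) D :
    uniq [seq parameter z | z <- Z] -> restrict i curve_shift f != 0 ->
    (size (restrict i curve_shift f) <= D.+1)%N ->
  (size Z <= nonzero_count f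
    [seq decode_point theta n (curve_point n i z) | z <- Z] + D)%N.
Proof.
move=> Z_uniq rf_neq0 rf_size.
pose rf := map_poly (in_alg E) (restrict i curve_shift f).
have -> : nonzero_count f
      [seq decode_point theta n (curve_point n i z) | z <- Z] =
    count (predC (root rf)) (map parameter Z).
  rewrite /nonzero_count !count_map; apply: eq_count => z.
  by rewrite /= meval_curve_point.
rewrite -(size_map parameter) -(count_predC (root rf)) addnC leq_add2l.
rewrite -size_filter -ltnS; apply: leq_trans rf_size.
rewrite -(size_map_poly (in_alg E)).
apply: max_poly_roots; rewrite ?map_poly_eq0 ?filter_uniq //.
by apply/allP => x; rewrite mem_filter => /andP[].
Qed.

End CurvePoints.

Lemma hitting_set_field (F : fieldType) n i N (elts : seq F) :
    uniq elts -> (1 < size elts)%N -> (1 < N)%N ->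
    (N <= size elts)%N \/ (forall x, x \in elts) ->
  exists (E : fieldExtType F) (theta : E) (Z : seq (seq F)),
    [/\ root_presents (Poly (hitting_set n i N elts).1) theta,
        (N <= size elts)%N -> {:E}%VS = 1%VS,
        (hitting_set n i N elts).2 = [seq curve_point n i z | z <- Z],
        size Z = N & uniq [seq parameter theta z | z <- Z]].
Proof.
move=> elts_uniq elts_gt1 N_gt1 elts_enough.
have [m [m_gt0 L_lists leNL m1]] := enum_listsP elts_uniq elts_gt1 N_gt1.
set L := enum_lists elts N in L_lists leNL; have [L_uniq _ mem_L] := L_lists.
have L_complete : m = 1%N \/ forall x, x \in elts.
  by case: elts_enough => [/m1|]; [left|right].
have [g_irr g_size] :=
  find_irreducibleP m_gt0 L_lists L_complete elts_uniq
    (leq_trans (ltnW N_gt1) leNL).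
have [E [theta [theta_g E_dim]]] := root_presents_exists g_irr.
exists E, theta, (take N L); split=> //.
- by move=> /m1 m_eq1; apply: E_dim; rewrite g_size m_eq1.
- by rewrite /= /mkseq map_nth_iota0.
- by rewrite size_takel.
rewrite map_inj_in_uniq ?take_uniq // => z z' /mem_take zL /mem_take z'L.
by apply: (parameter_inj theta_g g_size); [move: zL | move: z'L];
  rewrite mem_L => /andP[].
Qed.

Lemma hitting_set_correct (F : fieldType) n' r s d delta N (elts : seq F)
    (i := curve_degree r s n'.+1) (D := (d * delta * i)%N)
    (pts := (hitting_set n'.+1 i N elts).2) :
    (0 < r)%N -> (0 < s)%N -> (0 < d)%N -> (0 < delta)%N ->
    ((r - 1) ^ 2 <= d + 1)%N -> pchar_gt F D ->
    uniq elts -> (1 < size elts)%N -> (1 < N)%N ->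
    (N <= size elts)%N \/ (forall x, x \in elts) ->
  exists (E : fieldExtType F) (theta : E),
    let H := [seq decode_point theta n'.+1 pt | pt <- pts] in
    [/\ root_presents (Poly (hitting_set n'.+1 i N elts).1) theta,
        (N <= size elts)%N -> {:E}%VS = 1%VS,
        all (fun pt => size pt == n'.+1) pts,
        uniq H /\ size H = N &
        forall f : {mpoly F[n'.+1]}, f != 0 -> sum_pow_sparse r d s delta f ->
          (N <= nonzero_count f H + D)%N].
Proof.
move=> r_gt0 s_gt0 d_gt0 delta_gt0 le_rd charF elts_uniq elts_gt1 N_gt1
  elts_enough.
have [E [theta [Z [theta_g E_dim ptsE Z_size Z_uniq]]]] :=
  hitting_set_field n'.+1 i elts_uniq elts_gt1 N_gt1 elts_enough.
have i_gt0 : (0 < i)%N by rewrite !muln_gt0 r_gt0 s_gt0.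
have shift_inj : injective (@curve_shift F n').
  apply: (curve_shift_inj charF).
  rewrite /D /i /curve_degree mulnA leq_pmull // !muln_gt0.
  by rewrite d_gt0 delta_gt0 r_gt0 s_gt0.
exists E, theta; rewrite /pts ptsE -map_comp; split=> //.
- by apply/allP => _ /mapP[z _ ->]; rewrite /= size_mkseq.
- by rewrite size_map Z_size; split=> //; apply: uniq_curve_points.
move=> f f_neq0 f_sum; rewrite -Z_size; apply: count_curve_points => //.
  exact: (restrict_sum_pow_neq0 shift_inj r_gt0 s_gt0 d_gt0 le_rd charF).
exact: size_restrict_sum_pow f_sum.
Qed.

Lemma has_characteristic_pchar_gt (F : fieldType) p T :
  has_characteristic F p -> p = 0%N \/ (T < p)%N -> pchar_gt F T.
Proof.
move=> [[_ char0]|pF] p_large q qF; first by have := char0 q; rewrite qF.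
have [eq_qp|//] := p_large; first by have := pcharf_prime pF; rewrite eq_qp.
by move: qF; rewrite (pcharf_eq pF) => /eqP ->.
Qed.

Lemma restricted_degree_lt n r s d delta :
    (0 < r)%N -> (0 < d)%N -> (0 < delta)%N ->
  (d * delta * curve_degree r s n < r * d * delta * (s ^ 2 * n + delta))%N.
Proof.
move=> r_gt0 d_gt0 delta_gt0.
have -> : (d * delta * curve_degree r s n = r * d * delta * (s ^ 2 * n))%N.
  by rewrite /curve_degree; ring.
by rewrite ltn_pmul2l ?muln_gt0 ?r_gt0 ?d_gt0 // -[ltnLHS]addn0 ltn_add2l.
Qed.

Lemma rev_take_elts (T : eqType) (x0 x1 : T) (elts : seq T) N
    (l := rev (take N elts)) :
    x0 != x1 -> uniq elts -> (1 < N)%N ->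
    (N <= size elts)%N \/ (forall x, x \in elts) ->
  [/\ uniq l, (1 < size l)%N, (N <= size l)%N \/ (forall x, x \in l) &
      (N <= size elts)%N -> (N <= size l)%N].
Proof.
move=> ne_x01 elts_uniq N_gt1 elts_enough.
have l_uniq : uniq l by rewrite rev_uniq take_uniq.
have l_size : size l = minn N (size elts) by rewrite size_rev size_take_min.
have [leN|ltN] := leqP N (size elts).
  by rewrite l_size (minn_idPl leN); split=> //; left.
have l_all x : x \in l.
  rewrite mem_rev take_oversize; last exact: ltnW.
  by case: elts_enough => //; rewrite leqNgt ltN.
split=> //; last by right.
by apply: (@uniq_leq_size _ [:: x0; x1]); rewrite //= inE ne_x01.
Qed.

Section RealBounds.

Variables (R : archiRealFieldType) (eps : R).
Hypothesis eps_gt0 : 0 < eps.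

Lemma num_points_le_bound C n r s d delta (k := Num.truncn eps^-1) :
    (2 <= C)%N -> (0 < n)%N -> (0 < r)%N -> (0 < s)%N -> (0 < delta)%N ->
    (0 < k)%N ->
  (num_points n r s d delta k)%:R <=
    C%:R * (r ^ 4 * s ^ 4 * n ^ 2 * d * delta ^ 3)%:R / eps.
Proof.
move=> C_ge2 n_gt0 r_gt0 s_gt0 delta_gt0 k_gt0.
apply: (@le_trans _ _ (C * (r ^ 4 * s ^ 4 * n ^ 2 * d * delta ^ 3) * k)%:R).
  rewrite ler_nat.
  have -> : (C * (r ^ 4 * s ^ 4 * n ^ 2 * d * delta ^ 3) * k =
      d * delta * curve_degree r s n *
      ((r ^ 3 * s ^ 2 * n * delta ^ 2) * (C * k)))%N.
    by rewrite /curve_degree; ring.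
  rewrite leq_mul2l; apply/orP; right.
  apply: (@leq_trans (1 * (2 * k))); first by lia.
  by rewrite leq_mul ?leq_mul // !muln_gt0 r_gt0 s_gt0 n_gt0 delta_gt0.
rewrite natrM natrM ler_wpM2l ?mulr_ge0 ?ler0n //.
by rewrite truncn_le // invr_ge0 ltW.
Qed.

Lemma nonzero_fraction D cnt (N := (D * (Num.truncn eps^-1).+1)%N) :
  (N <= cnt + D)%N -> (1 - eps) * N%:R <= cnt%:R.
Proof.
rewrite -(ler_nat R) natrD => N_le.
rewrite mulrBl mul1r lerBlDr; apply: le_trans N_le _; rewrite lerD2l.
rewrite /N natrM mulrCA ler_peMr ?ler0n // -ler_pdivrMl // mulr1.
exact/ltW/truncnS_gt.
Qed.

End RealBounds.

Lemma root_presents_X (F : fieldType) :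
  exists (E : fieldExtType F) (theta : E),
    root_presents (Poly [:: 0; 1]) theta /\ {:E}%VS = 1%VS.
Proof.
have -> : Poly [:: 0; 1] = 'X + 0%:P :> {poly F}.
  by rewrite /= !cons_poly_def mul0r add0r mul1r.
have [E [theta [theta_X E_dim]]] := root_presents_exists (irredp_XaddC (0 : F)).
by exists E, theta; split=> //; apply: E_dim; rewrite size_XaddC.
Qed.

Lemma hitting_set_rev_take (F : fieldType) p n' r s d delta k (elts : seq F)
    (N := num_points n'.+1 r s d delta k.+1)
    (out := hitting_set n'.+1 (curve_degree r s n'.+1) N (rev (take N elts))) :
    (0 < r)%N -> (0 < s)%N -> (0 < d)%N -> (0 < delta)%N ->
    ((r - 1) ^ 2 <= d + 1)%N -> has_characteristic F p ->
    p = 0%N \/ (r * d * delta * (s ^ 2 * n'.+1 + delta) <= p)%N ->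
    uniq elts -> (N <= size elts)%N \/ (forall x, x \in elts) ->
  exists (E : fieldExtType F) (theta : E),
    let H := [seq decode_point theta n'.+1 pt | pt <- out.2] in
    [/\ root_presents (Poly out.1) theta,
        (N <= size elts)%N -> {:E}%VS = 1%VS,
        all (fun pt => size pt == n'.+1) out.2,
        uniq H /\ size H = N &
        forall f : {mpoly F[n'.+1]}, f != 0 -> sum_pow_sparse r d s delta f ->
          (N <= nonzero_count f H + d * delta * curve_degree r s n'.+1)%N].
Proof.
move=> r_gt0 s_gt0 d_gt0 delta_gt0 le_rd charF p_large elts_uniq elts_enough.
have lt_kN : (k.+1 < N)%N by apply: ltn_num_points.
have N_gt1 : (1 < N)%N by apply: leq_ltn_trans lt_kN.
have ne_01 : 0 != 1 :> F by rewrite eq_sym oner_eq0.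
have [l_uniq l_gt1 l_enough le_l] :=
  rev_take_elts ne_01 elts_uniq N_gt1 elts_enough.
have charD : pchar_gt F (d * delta * curve_degree r s n'.+1).
  apply: (has_characteristic_pchar_gt charF); case: p_large => [|p_ge];
    [by left | right].
  exact: leq_trans (restricted_degree_lt _ _ r_gt0 d_gt0 delta_gt0) p_ge.
have [E [theta [theta_g E_dim pts_size H_uniq nonzero_le]]] :=
  hitting_set_correct r_gt0 s_gt0 d_gt0 delta_gt0 le_rd charD l_uniq l_gt1 N_gt1
    l_enough.
by exists E, theta; split=> // /le_l/E_dim.
Qed.

Theorem theorem3p2 :
  exists (P : hs_program) (C : nat),
  forall (n r s d delta : nat),
    (0 < n)%N -> (0 < r)%N -> (0 < s)%N -> (0 < d)%N -> (0 < delta)%N ->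
    ((r - 1) ^ 2 <= d + 1)%N ->
  forall (F : fieldType) (p : nat),
    has_characteristic F p ->
    p = 0%N \/ (r * d * delta * (s ^ 2 * n + delta) <= p)%N ->
  forall (R : archiRealFieldType) (eps : R), 0 < eps ->
  let bound : R :=
    C%:R * (r ^ 4 * s ^ 4 * n ^ 2 * d * delta ^ 3)%:R / eps in
  forall elts : seq F, uniq elts ->
    bound <= (size elts)%:R \/ (forall x : F, x \in elts) ->
  let input := hs_input n r s d delta (Num.truncn eps^-1) elts in
  let g : seq F := (eval P input).1 in
  let pts : seq (seq (seq F)) := (eval P input).2 in
  exists (E : fieldExtType F) (theta : E),
    let H : seq {ffun 'I_n -> E} := map (decode_point theta n) pts in
    root_presents (Poly g) theta /\
    (bound <= (size elts)%:R -> {:E}%VS = 1%VS) /\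
    all (fun pt => size pt == n) pts /\
    uniq H /\
    (eps <= 1 -> (0 < size H)%N) /\
    (size H)%:R <= bound /\
    (cost P input <= C * (size H).+1 ^ C)%N /\
    forall f : {mpoly F[n]},
      f != 0 -> sum_pow_sparse r d s delta f ->
      (1 - eps) * (size H)%:R <= (nonzero_count f H)%:R.
Proof.
have [P [C [C_ge2 P_spec]]] := hs_program_exists; exists P, C.
move=> [//|n'] r s d delta n_gt0 r_gt0 s_gt0 d_gt0 delta_gt0 le_rd F p charF
  p_large.
move=> R eps eps_gt0 bound elts elts_uniq elts_enough.
have [evalP0 costP0 P_specS] := P_spec F n'.+1 r s d delta elts.
cbv zeta; case Ek: (Num.truncn eps^-1) => [|k].
  have [E [theta [theta_X E1]]] := root_presents_X F.
  exists E, theta; rewrite evalP0; do 5![split=> //].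
    by move=> eps_le1; have /truncn0Pn/negP[] := Ek; rewrite invf_ge1.
  split; first by rewrite !mulr_ge0 ?invr_ge0 ?ler0n // ltW.
  by split=> [|f _ _]; rewrite ?exp1n ?muln1 ?mulr0.
have [evalP costP] := P_specS k n_gt0 r_gt0 s_gt0 d_gt0 delta_gt0.
set N := num_points _ _ _ _ _ _ in evalP costP.
have N_le : N%:R <= bound by rewrite /N -Ek num_points_le_bound ?Ek.
have le_elts : bound <= (size elts)%:R -> (N <= size elts)%N.
  by move/(le_trans N_le); rewrite ler_nat.
have {}elts_enough : (N <= size elts)%N \/ (forall x, x \in elts).
  by case: elts_enough => [/le_elts|]; [left | right].
have [E [theta [theta_g E_dim pts_size [H_uniq H_size] nonzero_le]]] :=
  hitting_set_rev_take r_gt0 s_gt0 d_gt0 delta_gt0 le_rd charF p_large elts_uniq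
    elts_enough.
exists E, theta; rewrite evalP H_size; do 2!split=> //;
  first by move=> /le_elts/E_dim.
do 2!split=> //; split;
  first by rewrite ltnW // (leq_ltn_trans _ (ltn_num_points _ _ _ _ _ _)).
do 2!split=> //; move=> f f_neq0 f_sum.
by rewrite /N /num_points -Ek nonzero_fraction // Ek -/N nonzero_le.
Qed.
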